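(* Let $V\subseteq W$ be transitive models of ZFC such that $(V,W)$ satisfies the $\kappa$-covering and the $\kappa$-approximation properties, where $\kappa$ is inaccessible in $V$, and let $\lambda\ge\kappa$ be a cardinal of $V$. If $W\models\mathsf{TP}(\kappa,\lambda)$, then $V\models\mathsf{TP}(\kappa,\lambda)$.
   Context: $P_\kappa\lambda=\{a\subseteq\lambda:|a|<\kappa\}$. A $P_\kappa\lambda$-list is $D=\langle d_a:a\in P_\kappa\lambda\rangle$ with $d_a\subseteq a$; thin means there is a club $C\subseteq P_\kappa\lambda$ with $|\{d_a\cap c : c\subseteq a\in P_\kappa\lambda\}|<\kappa$ for all $c\in C$. $d\subseteq\lambda$ is a cofinal branch of $D$ if for every $a\in P_\kappa\lambda$ there is $z_a\in P_\kappa\lambda$ with $a\subseteq z_a$ and $d\cap a=d_{z_a}\cap a$. $\mathsf{TP}(\kappa,\lambda)$: every thin $P_\kappa\lambda$-list has a cofinal branch. $(V,W)$ has the $\kappa$-covering property if every $x\in W$, $x\subseteq V$, $|x|^W<\kappa$ is contained in some $z\in V$ with $|z|^V<\kappa$; it has the $\kappa$-approximation property if every $x\in W$ with $x\subseteq V$ such that $x\cap z\in V$ for all $z\in V$ with $z\subseteq V$, $|z|^V<\kappa$, belongs to $V$. *)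

(* Defs.v *)
(* By the Mostowski collapse, a transitive model is, up to isomorphism, a
   transitive class of an extensional well-founded structure.  A class is an
   arbitrary predicate, so both set models and proper class models are covered. *)
Record universe := Universe {
  sort :> Type;
  mem : sort -> sort -> Prop;
  mem_ext : forall x y, (forall z, mem z x <-> mem z y) -> x = y;
  mem_wf : well_founded mem
}.
Arguments mem {u} _ _.

Notation "x ∈ y" := (mem x y) (at level 70, no associativity).

Notation "∀[ M ] x , P" := (forall x, M x -> P)
  (at level 200, M at level 99, x name, P at level 200, right associativity).
Notation "∃[ M ] x , P" := (exists x, M x /\ P)
  (at level 200, M at level 99, x name, P at level 200, right associativity).

Definition class (U : universe) := U -> Prop.

(* Formulas of the language {∈, =}, with de Bruijn indices. *)
Inductive formula : Type :=
| FMem (i j : nat)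
| FEq (i j : nat)
| FBot
| FImp (p q : formula)
| FAll (p : formula).

Definition scons {U : universe} (x : U) (e : nat -> U) : nat -> U :=
  fun n => match n with O => x | S m => e m end.

Fixpoint sat {U : universe} (M : class U) (e : nat -> U) (p : formula) : Prop :=
  match p with
  | FMem i j => e i ∈ e j
  | FEq i j => e i = e j
  | FBot => False
  | FImp p q => sat M e p -> sat M e q
  | FAll p => ∀[M] x, sat M (scons x e) p
  end.

(* In ZFC and in every definition with suffix _in, all quantifiers over sets
   range over M: it is the relativization to M of the usual formula, so that "M satisfies the
   formula" is what it unfolds to. *)

Definition sub_in {U : universe} (M : class U) (x y : U) : Prop :=
  ∀[M] z, z ∈ x -> z ∈ y.

Definition empty_in {U : universe} (M : class U) (x : U) : Prop :=
  ∀[M] z, ~ z ∈ x.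

Definition upair_in {U : universe} (M : class U) (a b p : U) : Prop :=
  ∀[M] z, z ∈ p <-> z = a \/ z = b.

Definition opair_in {U : universe} (M : class U) (a b p : U) : Prop :=
  ∃[M] s, ∃[M] t, upair_in M a a s /\ upair_in M a b t /\ upair_in M s t p.

Definition inter_in {U : universe} (M : class U) (x y i : U) : Prop :=
  ∀[M] z, z ∈ i <-> z ∈ x /\ z ∈ y.

Definition union_in {U : universe} (M : class U) (x u : U) : Prop :=
  ∀[M] z, z ∈ u <-> ∃[M] y, y ∈ x /\ z ∈ y.

Definition power_in {U : universe} (M : class U) (x p : U) : Prop :=
  ∀[M] z, z ∈ p <-> sub_in M z x.

Definition succ_in {U : universe} (M : class U) (x s : U) : Prop :=
  ∀[M] z, z ∈ s <-> z ∈ x \/ z = x.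

(* f(a) = b, for a function f *)
Definition app_in {U : universe} (M : class U) (f a b : U) : Prop :=
  ∃[M] p, opair_in M a b p /\ p ∈ f.

Definition function_on_in {U : universe} (M : class U) (f : U) (A : class U)
  : Prop :=
  (∀[M] p, p ∈ f -> ∃[M] a, ∃[M] b, A a /\ opair_in M a b p) /\
  (∀[M] a, A a -> ∃[M] b, app_in M f a b /\ ∀[M] c, app_in M f a c -> c = b).

Definition map_in {U : universe} (M : class U) (f x y : U) : Prop :=
  function_on_in M f (fun a => a ∈ x) /\
  ∀[M] a, ∀[M] b, app_in M f a b -> b ∈ y.

Definition bijection_in {U : universe} (M : class U) (f x y : U) : Prop :=
  map_in M f x y /\
  (∀[M] a, ∀[M] b, ∀[M] c, app_in M f a c -> app_in M f b c -> a = b) /\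
  (∀[M] b, b ∈ y -> ∃[M] a, app_in M f a b).

Definition equinumerous_in {U : universe} (M : class U) (x y : U) : Prop :=
  ∃[M] f, bijection_in M f x y.

Record ZFC {U : universe} (M : class U) : Prop := {
  zfc_extensionality :
    ∀[M] x, ∀[M] y, (∀[M] z, z ∈ x <-> z ∈ y) -> x = y;
  zfc_foundation :
    ∀[M] x, (∃[M] y, y ∈ x) -> ∃[M] y, y ∈ x /\ ∀[M] z, z ∈ x -> ~ z ∈ y;
  zfc_pairing :
    ∀[M] a, ∀[M] b, ∃[M] p, upair_in M a b p;
  zfc_union :
    ∀[M] x, ∃[M] u, union_in M x u;
  zfc_power :
    ∀[M] x, ∃[M] p, power_in M x p;
  zfc_infinity :
    ∃[M] i, (∃[M] o, empty_in M o /\ o ∈ i) /\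
            (∀[M] x, x ∈ i -> ∃[M] s, succ_in M x s /\ s ∈ i);
  zfc_separation :
    forall (p : formula) (e : nat -> U), (forall n, M (e n)) ->
    ∀[M] a, ∃[M] b, ∀[M] x, x ∈ b <-> x ∈ a /\ sat M (scons x e) p;
  zfc_replacement :
    forall (p : formula) (e : nat -> U), (forall n, M (e n)) ->
    ∀[M] a,
    (∀[M] x, x ∈ a -> ∀[M] y, ∀[M] z,
       sat M (scons x (scons y e)) p -> sat M (scons x (scons z e)) p ->
       y = z) ->
    ∃[M] b, ∀[M] y,
      y ∈ b <-> ∃[M] x, x ∈ a /\ sat M (scons x (scons y e)) p;
  zfc_choice :
    ∀[M] x, (∀[M] y, y ∈ x -> ∃[M] z, z ∈ y) ->
    ∃[M] f, function_on_in M f (fun y => y ∈ x) /\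
            ∀[M] y, ∀[M] z, app_in M f y z -> z ∈ y
}.

Definition transitive_class {U : universe} (M : class U) : Prop :=
  forall x y, M x -> y ∈ x -> M y.

Definition transitive_model {U : universe} (M : class U) : Prop :=
  transitive_class M /\ ZFC M.

(* A transitive set strictly well-ordered by membership. *)
Record ordinal_in {U : universe} (M : class U) (a : U) : Prop := {
  ord_transitive : ∀[M] x, x ∈ a -> sub_in M x a;
  ord_irrefl : ∀[M] x, x ∈ a -> ~ x ∈ x;
  ord_trans : ∀[M] x, ∀[M] y, ∀[M] z,
    x ∈ a -> y ∈ a -> z ∈ a -> x ∈ y -> y ∈ z -> x ∈ z;
  ord_total : ∀[M] x, ∀[M] y, x ∈ a -> y ∈ a -> x ∈ y \/ x = y \/ y ∈ x;
  ord_least : ∀[M] s, sub_in M s a -> (∃[M] x, x ∈ s) ->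
    ∃[M] x, x ∈ s /\ ∀[M] y, y ∈ s -> x = y \/ x ∈ y
}.

Definition cardinal_in {U : universe} (M : class U) (k : U) : Prop :=
  ordinal_in M k /\ ∀[M] a, a ∈ k -> ~ equinumerous_in M a k.

(* |x| < k, where |x| is the cardinal equinumerous with x and < is the order of
   the ordinals; this makes sense when k is merely an ordinal of M. *)
Definition card_lt_in {U : universe} (M : class U) (x k : U) : Prop :=
  ∃[M] m, cardinal_in M m /\ equinumerous_in M x m /\ m ∈ k.

Definition limit_in {U : universe} (M : class U) (a : U) : Prop :=
  ordinal_in M a /\ ~ empty_in M a /\
  ∀[M] x, x ∈ a -> ∃[M] y, y ∈ a /\ x ∈ y.

Definition omega_in {U : universe} (M : class U) (w : U) : Prop :=
  limit_in M w /\ ∀[M] x, x ∈ w -> ~ limit_in M x.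

Definition uncountable_in {U : universe} (M : class U) (k : U) : Prop :=
  ∃[M] w, omega_in M w /\ w ∈ k.

(* For an infinite cardinal k: no map from a smaller ordinal is cofinal in k. *)
Definition regular_in {U : universe} (M : class U) (k : U) : Prop :=
  ∀[M] a, a ∈ k -> ∀[M] f, map_in M f a k ->
  ∃[M] b, b ∈ k /\ ∀[M] x, ∀[M] y, app_in M f x y -> y ∈ b.

Definition strong_limit_in {U : universe} (M : class U) (k : U) : Prop :=
  ∀[M] m, m ∈ k -> ∀[M] p, power_in M m p -> card_lt_in M p k.

Definition inaccessible_in {U : universe} (M : class U) (k : U) : Prop :=
  cardinal_in M k /\ uncountable_in M k /\ regular_in M k /\
  strong_limit_in M k.

(* a belongs to P_k l *)
Definition Pkl_in {U : universe} (M : class U) (k l a : U) : Prop :=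
  sub_in M a l /\ card_lt_in M a k.

(* Closed: under unions of nonempty chains with fewer than k members. *)
Definition club_in {U : universe} (M : class U) (k l C : U) : Prop :=
  (∀[M] c, c ∈ C -> Pkl_in M k l c) /\
  (∀[M] a, Pkl_in M k l a -> ∃[M] c, c ∈ C /\ sub_in M a c) /\
  (∀[M] X, sub_in M X C -> (∃[M] x, x ∈ X) -> card_lt_in M X k ->
     (∀[M] x, ∀[M] y, x ∈ X -> y ∈ X -> sub_in M x y \/ sub_in M y x) ->
     ∀[M] u, union_in M X u -> u ∈ C).

Definition list_in {U : universe} (M : class U) (k l D : U) : Prop :=
  function_on_in M D (Pkl_in M k l) /\
  ∀[M] a, ∀[M] d, app_in M D a d -> sub_in M d a.

(* S is { d_a ∩ c : c ⊆ a ∈ P_k l } *)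
Definition traces_in {U : universe} (M : class U) (k l D c S : U) : Prop :=
  ∀[M] s, s ∈ S <->
    ∃[M] a, Pkl_in M k l a /\ sub_in M c a /\
    ∃[M] d, app_in M D a d /\ inter_in M d c s.

Definition thin_in {U : universe} (M : class U) (k l D : U) : Prop :=
  ∃[M] C, club_in M k l C /\
  ∀[M] c, c ∈ C -> ∃[M] S, traces_in M k l D c S /\ card_lt_in M S k.

Definition cofinal_branch_in {U : universe} (M : class U) (k l D d : U) : Prop :=
  sub_in M d l /\
  ∀[M] a, Pkl_in M k l a ->
  ∃[M] z, Pkl_in M k l z /\ sub_in M a z /\
  ∃[M] e, app_in M D z e /\ ∃[M] i, inter_in M d a i /\ inter_in M e a i.

Definition TP_in {U : universe} (M : class U) (k l : U) : Prop :=
  ∀[M] D, list_in M k l D -> thin_in M k l D ->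
  ∃[M] d, cofinal_branch_in M k l D d.

Definition sub_class {U : universe} (x : U) (V : class U) : Prop :=
  forall y, y ∈ x -> V y.

Definition covering {U : universe} (V W : class U) (k : U) : Prop :=
  ∀[W] x, sub_class x V -> card_lt_in W x k ->
  ∃[V] z, card_lt_in V z k /\ forall y, y ∈ x -> y ∈ z.

Definition approximation {U : universe} (V W : class U) (k : U) : Prop :=
  ∀[W] x, sub_class x V ->
  (∀[V] z, sub_class z V -> card_lt_in V z k ->
     ∃[V] i, forall y, y ∈ i <-> y ∈ x /\ y ∈ z) ->
  V x.

(* Main.v *)
From Stdlib Require Import Classical.
Require Import Defs.

(** Let [D] be a [P_kappa lambda]-list of [V].  By covering, every
    [a ∈ P_kappa lambda] of [W] is contained in some [z ∈ P_kappa lambda] of [V],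
    and [W] can choose such a [z] for each [a], because the candidates are the
    members of the domain of [D].  The restrictions [e_a = d_z ∩ a] form a list
    [E] in [W].  Its traces on [c] are traces on [c] of sets in the [V]-power set
    of a cover of [c], which is small since [kappa] is inaccessible in [V]; so [E]
    is thin, with all of [P_kappa lambda] as the club.  If [d] is a cofinal branch
    of [E] in [W], then on every [a ∈ P_kappa lambda] of [V] it agrees with some
    [d_z], [a ⊆ z]; so [d] belongs to [V] by approximation, and it is a cofinal
    branch of [D]. *)

(** * Definability with parameters *)

(** [V] need not be definable in [W], so separation and choice in [W] cannot speak of the sets of
    [V]; the single parameter [D] can, because its domain is the [P_kappa lambda] of [V]. Regularity
    and the strong limit property of [kappa] are facts about [V] and are applied inside [V] only;
    the resulting bounds then pass to [W]. For this reason sizes are compared by partial surjections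
    from ordinals below [kappa] rather than by bijections with cardinals: a cardinal of [V] may fail
    to be one in [W], whereas a surjection of [V] is still a surjection in [W]. The link with
    cardinals is made once for any transitive model, by collapsing a set of ordinals. The schemas of
    ZFC are stated for syntactic formulas, so every set built inside a model needs a defining
    formula. A small calculus of definable predicates produces these formulas, and it favours
    notions with bounded quantifiers and constructions without ordinal recursion. *)

Fixpoint interleave {A : Type} (e g : nat -> A) (n : nat) : A :=
  match n with
  | 0 => e 0
  | 1 => g 0
  | S (S m) => interleave (fun i => e (S i)) (fun i => g (S i)) m
  end.

Fixpoint double (n : nat) : nat :=
  match n with 0 => 0 | S m => S (S (double m)) end.

Lemma interleave_even {A : Type} i (e g : nat -> A) :
  interleave e g (double i) = e i.
Proof. revert e g; induction i; intros; simpl; auto; now rewrite IHi. Qed.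

Lemma interleave_odd {A : Type} i (e g : nat -> A) :
  interleave e g (S (double i)) = g i.
Proof.
  revert e g; induction i; intros; [reflexivity|].
  change (interleave (fun i => e (S i)) (fun i => g (S i)) (S (double i)) = g (S i)).
  now rewrite IHi.
Qed.

(** Since [interleave] recurses two steps at a time, the induction carries two consecutive indices.
    With an equation as [P], it reduces the correctness of a renaming to separate checks for
    variables and for parameters. *)
Lemma interleave_all {A B : Type} (P : A -> B -> Prop) e g e' g' :
  (forall i, P (e i) (e' i)) -> (forall i, P (g i) (g' i)) ->
  forall n, P (interleave e g n) (interleave e' g' n).
Proof.
  intros He Hg n.
  enough (P (interleave e g n) (interleave e' g' n) /\
          P (interleave e g (S n)) (interleave e' g' (S n))) by tauto.
  revert e g e' g' He Hg; induction n as [|n IH]; intros e g e' g' He Hg.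
  - split; [apply He|apply Hg].
  - split; [now apply IH|].
    apply (IH (fun i => e (S i)) (fun i => g (S i))
              (fun i => e' (S i)) (fun i => g' (S i))); auto.
Qed.

Fixpoint rename (r : nat -> nat) (p : formula) : formula :=
  match p with
  | FMem i j => FMem (r i) (r j)
  | FEq i j => FEq (r i) (r j)
  | FBot => FBot
  | FImp p q => FImp (rename r p) (rename r q)
  | FAll p => FAll (rename (fun n => match n with 0 => 0 | S m => S (r m) end) p)
  end.

Lemma sat_rename {U : universe} (M : class U) p r e e' :
  (forall i, e (r i) = e' i) -> sat M e (rename r p) <-> sat M e' p.
Proof.
  revert r e e'; induction p as [i j|i j| |p IHp q IHq|p IHp];
    intros r e e' He; simpl.
  - now rewrite !He.
  - now rewrite !He.
  - reflexivity.
  - now rewrite (IHp r e e' He), (IHq r e e' He).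
  - split; intros H x Hx; specialize (H x Hx); revert H;
      apply IHp; intros [|i]; simpl; auto.
Qed.

Section Definability.
Context {U : universe} (M : class U).

(* Even indices are the free variables, odd indices the parameters. *)
Definition definable (P : (nat -> U) -> Prop) : Prop :=
  exists p g, (forall i, M (g i)) /\
    forall e, (forall i, M (e i)) -> sat M (interleave e g) p <-> P e.

(** The language has no function symbols, so variables and parameters are the only terms. *)
Definition term (t : (nat -> U) -> U) : Prop :=
  (exists i, t = fun e => e i) \/ (exists c, M c /\ t = fun _ => c).

Lemma term_var i : term (fun e => e i).
Proof. left; eauto. Qed.

Lemma term_const c : M c -> term (fun _ => c).
Proof. right; eauto. Qed.

Lemma term_shift t : term t -> term (fun e => t (fun n => e (S n))).
Proof.
  intros [[i ->]|[c [Hc ->]]]; [apply (term_var (S i))|now apply term_const].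
Qed.

Lemma def_ext P Q :
  definable P -> (forall e, (forall i, M (e i)) -> P e <-> Q e) -> definable Q.
Proof.
  intros (p & g & Hg & H) HPQ; exists p, g; split; auto.
  intros e He; rewrite H by auto; auto.
Qed.

Lemma def_reindex (P : (nat -> U) -> Prop) r :
  definable P -> definable (fun e => P (fun n => e (r n))).
Proof.
  intros (p & g & Hg & H).
  exists (rename (interleave (fun n => double (r n)) (fun n => S (double n))) p), g.
  split; auto; intros e He.
  rewrite (sat_rename M p _ _ (interleave (fun n => e (r n)) g)).
  - apply H; auto.
  - apply interleave_all with (P := fun a b => interleave e g a = b); intros j.
    + apply interleave_even.
    + apply interleave_odd.
Qed.

(** Variable 0 is renamed to index 1, the first parameter slot, where [c] is inserted; the old
    parameters move up by one slot and the other variables move down by one. *)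
Lemma def_const (P : U -> (nat -> U) -> Prop) c :
  M c -> definable (fun e => P (e 0) (fun n => e (S n))) ->
  definable (fun e => P c e).
Proof.
  intros Hc (p & g & Hg & H).
  exists (rename (interleave
      (fun n => match n with 0 => 1 | S m => double m end)
      (fun n => S (double (S n)))) p), (scons c g).
  split; [intros [|j]; simpl; auto|]; intros e He.
  rewrite (sat_rename M p _ _ (interleave (scons c e) g)).
  - rewrite H; [reflexivity|intros [|j]; simpl; auto].
  - apply interleave_all with
      (P := fun a b => interleave e (scons c g) a = b); intros j.
    + destruct j; simpl; [reflexivity|apply interleave_even].
    + now rewrite interleave_odd.
Qed.

Lemma def_term (P : U -> (nat -> U) -> Prop) t :
  term t -> definable (fun e => P (e 0) (fun n => e (S n))) ->
  definable (fun e => P (t e) e).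
Proof.
  intros [[i ->]|[c [Hc ->]]] H.
  - exact (def_reindex _ (fun n => match n with 0 => i | S m => m end) H).
  - now apply def_const.
Qed.

Lemma def_term1 (P : U -> Prop) t :
  definable (fun e => P (e 0)) -> term t -> definable (fun e => P (t e)).
Proof. intros H Ht; now apply (def_term (fun x _ => P x)). Qed.

Lemma def_term2 (P : U -> U -> Prop) t s :
  definable (fun e => P (e 0) (e 1)) -> term t -> term s ->
  definable (fun e => P (t e) (s e)).
Proof.
  intros H Ht Hs; apply (def_term (fun x e => P x (s e))); auto.
  apply (def_term (fun x e => P (e 0) x) (fun e => s (fun n => e (S n)))).
  - now apply term_shift.
  - exact (def_reindex _ (fun n => match n with 0 => 1 | _ => 0 end) H).
Qed.

Lemma def_term3 (P : U -> U -> U -> Prop) t s r :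
  definable (fun e => P (e 0) (e 1) (e 2)) -> term t -> term s -> term r ->
  definable (fun e => P (t e) (s e) (r e)).
Proof.
  intros H Ht Hs Hr; apply (def_term (fun x e => P x (s e) (r e))); auto.
  apply (def_term (fun x e => P (e 0) x (r (fun n => e (S n))))
                  (fun e => s (fun n => e (S n)))).
  - now apply term_shift.
  - apply (def_term (fun x e => P (e 1) (e 0) x)
                    (fun e => r (fun n => e (S (S n))))).
    + now apply (term_shift (fun e => r (fun n => e (S n)))), term_shift.
    + exact (def_reindex _
        (fun n => match n with 0 => 2 | 1 => 1 | _ => 0 end) H).
Qed.

Lemma def_false : (exists x, M x) -> definable (fun _ => False).
Proof. intros [x Hx]; exists FBot, (fun _ => x); simpl; tauto. Qed.

Lemma def_mem t s :
  (exists x, M x) -> term t -> term s -> definable (fun e => t e ∈ s e).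
Proof.
  intros [x Hx]; apply def_term2.
  exists (FMem 0 2), (fun _ => x); simpl; tauto.
Qed.

Lemma def_eq t s :
  (exists x, M x) -> term t -> term s -> definable (fun e => t e = s e).
Proof.
  intros [x Hx]; apply (def_term2 eq).
  exists (FEq 0 2), (fun _ => x); simpl; tauto.
Qed.

(** The two parameter sequences are themselves interleaved, so each formula keeps its own parameters
    while the free variables are shared. *)
Lemma def_imp P Q :
  definable P -> definable Q -> definable (fun e => P e -> Q e).
Proof.
  intros (p & g & Hg & HP) (q & h & Hh & HQ).
  exists (FImp
    (rename (interleave double (fun n => S (double (double n)))) p)
    (rename (interleave double (fun n => S (double (S (double n))))) q)).
  exists (interleave g h); split.
  { intros i; apply (interleave_all (fun a (_ : nat) => M a) g h (fun _ => 0)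
                       (fun _ => 0)); auto. }
  intros e He; simpl.
  rewrite (sat_rename M p _ _ (interleave e g)), (sat_rename M q _ _ (interleave e h)).
  - now rewrite HP, HQ.
  - apply interleave_all with
      (P := fun a b => interleave e (interleave g h) a = b); intros j.
    + apply interleave_even.
    + etransitivity; apply interleave_odd.
  - apply interleave_all with
      (P := fun a b => interleave e (interleave g h) a = b); intros j.
    + apply interleave_even.
    + etransitivity; [apply interleave_odd|apply interleave_even].
Qed.

(** The quantifier puts its value at index 0 and pushes everything else up by one, which swaps the
    parities of variables and parameters; the renaming compensates for this. *)
Lemma def_all (P : U -> (nat -> U) -> Prop) :
  definable (fun e => P (e 0) (fun n => e (S n))) ->
  definable (fun e => forall x, M x -> P x e).
Proof.
  intros (p & g & Hg & H).
  exists (FAll (rename (interleave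
      (fun n => match n with 0 => 0 | S m => S (double m) end)
      (fun n => S (S (double n)))) p)), g.
  split; auto; intros e He; simpl.
  enough (Hx : forall x, M x ->
      sat M (scons x (interleave e g)) (rename (interleave
      (fun n => match n with 0 => 0 | S m => S (double m) end)
      (fun n => S (S (double n)))) p) <-> P x e)
    by (split; intros K x Mx; specialize (K x Mx); now apply (Hx x Mx)).
  intros x Mx.
  rewrite (sat_rename M p _ _ (interleave (scons x e) g)).
  - rewrite H; [reflexivity|intros [|j]; simpl; auto].
  - apply interleave_all with
      (P := fun a b => scons x (interleave e g) a = b); intros j.
    + destruct j; simpl; [reflexivity|apply interleave_even].
    + apply interleave_odd.
Qed.

Lemma def_inhabited P : definable P -> exists x, M x.
Proof. intros (p & g & Hg & _); exists (g 0); auto. Qed.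

Lemma def_not P : definable P -> definable (fun e => ~ P e).
Proof.
  intros H; apply def_imp; auto.
  now apply def_false, (def_inhabited P).
Qed.

Lemma def_and P Q :
  definable P -> definable Q -> definable (fun e => P e /\ Q e).
Proof.
  intros HP HQ; apply (def_ext (fun e => ~ (P e -> ~ Q e))).
  - now apply def_not, def_imp, def_not.
  - intros; tauto.
Qed.

Lemma def_or P Q :
  definable P -> definable Q -> definable (fun e => P e \/ Q e).
Proof.
  intros HP HQ; apply (def_ext (fun e => ~ P e -> Q e)).
  - now apply def_imp; [apply def_not|].
  - intros; tauto.
Qed.

Lemma def_iff P Q :
  definable P -> definable Q -> definable (fun e => P e <-> Q e).
Proof. intros HP HQ; apply def_and; now apply def_imp. Qed.

Lemma def_ex (P : U -> (nat -> U) -> Prop) :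
  definable (fun e => P (e 0) (fun n => e (S n))) ->
  definable (fun e => exists x, M x /\ P x e).
Proof.
  intros H; apply (def_ext (fun e => ~ forall x, M x -> ~ P x e)).
  - apply def_not, def_all.
    exact (def_not _ H).
  - intros e _; split.
    + intros N; apply NNPP; intros K; apply N; intros x Mx Px; apply K; eauto.
    + intros (x & Mx & Px) K; exact (K x Mx Px).
Qed.

Hypothesis Mtrans : transitive_class M.

Lemma term_in t e : term t -> (forall i, M (e i)) -> M (t e).
Proof. intros [[i ->]|[c [Hc ->]]]; auto. Qed.

(** Transitivity places every member of a set of [M] in [M], so a bounded quantifier over the
    universe agrees with the relativized one. Absolute notions can thus be stated without mentioning
    [M]. *)
Lemma def_ball t (P : U -> (nat -> U) -> Prop) :
  term t -> definable (fun e => P (e 0) (fun n => e (S n))) ->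
  definable (fun e => forall x, x ∈ t e -> P x e).
Proof.
  intros Ht H; apply (def_ext (fun e => forall x, M x -> x ∈ t e -> P x e)).
  - apply def_all, def_imp; auto.
    apply (def_mem (fun e => e 0)); [now apply def_inhabited in H|apply term_var|].
    now apply term_shift.
  - intros e He; split; eauto using term_in.
Qed.

Lemma def_bex t (P : U -> (nat -> U) -> Prop) :
  term t -> definable (fun e => P (e 0) (fun n => e (S n))) ->
  definable (fun e => exists x, x ∈ t e /\ P x e).
Proof.
  intros Ht H; apply (def_ext (fun e => exists x, M x /\ x ∈ t e /\ P x e)).
  - apply def_ex, def_and; auto.
    apply (def_mem (fun e => e 0)); [now apply def_inhabited in H|apply term_var|].
    now apply term_shift.
  - intros e He; split; [intros (x & _ & Hx)|intros (x & Hx & Px)];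
      eauto 6 using term_in.
Qed.

End Definability.

(** * Absolute notions *)

Section Absolute.
Context {U : universe}.
Implicit Types a b f p x y z : U.

Definition sub x y : Prop := forall z, z ∈ x -> z ∈ y.

Definition upair a b p : Prop :=
  a ∈ p /\ b ∈ p /\ forall z, z ∈ p -> z = a \/ z = b.

(** The Kuratowski pair, with every quantifier bounded by the pair or one of its members; this makes
    it absolute for transitive models. *)
Definition opair a b p : Prop :=
  exists s, s ∈ p /\ exists t, t ∈ p /\
    upair a a s /\ upair a b t /\ upair s t p.

Definition app f a b : Prop := exists p, p ∈ f /\ opair a b p.

Definition functional f : Prop :=
  forall x a b, app f x a -> app f x b -> a = b.

Definition rel_on f x y : Prop :=
  forall p, p ∈ f -> exists a b, a ∈ x /\ b ∈ y /\ opair a b p.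

(** Irreflexivity and least elements come from the well-foundedness of [mem]. *)
Record ordinal x : Prop := {
  ordinal_sub : forall y, y ∈ x -> sub y x;
  ordinal_total : forall y z, y ∈ x -> z ∈ x -> y ∈ z \/ y = z \/ z ∈ y
}.

Lemma mem_irrefl x : ~ x ∈ x.
Proof.
  induction (mem_wf U x) as [x _ IH]; intros H; exact (IH x H H).
Qed.

Lemma mem_asym x y : x ∈ y -> ~ y ∈ x.
Proof.
  revert y; induction (mem_wf U x) as [x _ IH]; intros y Hxy Hyx.
  exact (IH y Hyx x Hyx Hxy).
Qed.

Lemma mem_acyclic3 x y z : x ∈ y -> y ∈ z -> ~ z ∈ x.
Proof.
  revert y z; induction (mem_wf U x) as [x _ IH]; intros y z Hxy Hyz Hzx.
  exact (IH z Hzx x y Hzx Hxy Hyz).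
Qed.

Lemma mem_minimal (P : U -> Prop) :
  (exists x, P x) -> exists x, P x /\ forall y, y ∈ x -> ~ P y.
Proof.
  intros [x Hx]; apply NNPP; intros N; revert Hx.
  induction (mem_wf U x) as [x _ IH]; intros Hx.
  apply N; exists x; split; auto.
Qed.

Lemma ordinal_mem x y : ordinal x -> y ∈ x -> ordinal y.
Proof.
  intros Hx Hy; split.
  - intros z Hz w Hw.
    assert (Hzx : z ∈ x) by exact (ordinal_sub x Hx y Hy z Hz).
    assert (Hwx : w ∈ x) by exact (ordinal_sub x Hx z Hzx w Hw).
    destruct (ordinal_total x Hx w y Hwx Hy) as [H|[->|H]]; auto.
    + now destruct (mem_asym y z).
    + now destruct (mem_acyclic3 y w z).
  - intros z w Hz Hw; apply (ordinal_total x Hx);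
      apply (ordinal_sub x Hx y Hy); auto.
Qed.

Lemma upair_unique a b p q : upair a b p -> upair a b q -> p = q.
Proof.
  intros (Ha & Hb & H) (Ha' & Hb' & H'); apply mem_ext; intros z; split; intros Hz.
  - destruct (H z Hz) as [->| ->]; auto.
  - destruct (H' z Hz) as [->| ->]; auto.
Qed.

Lemma opair_unique a b p q : opair a b p -> opair a b q -> p = q.
Proof.
  intros (s & _ & t & _ & Hs & Ht & Hp) (s' & _ & t' & _ & Hs' & Ht' & Hq).
  rewrite (upair_unique _ _ _ _ Hs' Hs), (upair_unique _ _ _ _ Ht' Ht) in Hq.
  now apply (upair_unique s t).
Qed.

Lemma opair_inj a b a' b' p : opair a b p -> opair a' b' p -> a = a' /\ b = b'.
Proof.
  intros (s & Hsp & t & Htp & Hs & Ht & Hp) (s' & Hsp' & t' & Htp' & Hs' & Ht' & Hq).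
  destruct Hs as (Has & _ & Hs), Hs' as (Has' & _ & Hs').
  destruct Ht as (Hat & Hbt & Ht), Ht' as (Hat' & Hbt' & Ht').
  assert (a = a') as <-.
  { destruct (proj2 (proj2 Hp) _ Hsp') as [-> | ->].
    - destruct (Hs _ Has'); auto.
    - destruct (Hs' _ Hat); auto. }
  split; auto.
  destruct (proj2 (proj2 Hp) _ Htp') as [-> | ->].
  - assert (b' = a) as -> by (destruct (Hs _ Hbt'); auto).
    destruct (proj2 (proj2 Hq) _ Htp) as [-> | ->].
    + destruct (Hs' _ Hbt); auto.
    + destruct (Ht' _ Hbt); auto.
  - destruct (Ht' _ Hbt) as [->|]; auto.
    destruct (Ht _ Hbt'); auto.
Qed.

Lemma sub_antisym x y : sub x y -> sub y x -> x = y.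
Proof. intros; apply mem_ext; split; auto. Qed.

Lemma rel_on_app f x y a b : rel_on f x y -> app f a b -> a ∈ x /\ b ∈ y.
Proof.
  intros Hf (p & Hp & Hab); destruct (Hf p Hp) as (a' & b' & Ha & Hb & H).
  destruct (opair_inj _ _ _ _ _ Hab H) as [-> ->]; auto.
Qed.

End Absolute.

(** * Constructions inside one transitive model of ZFC *)

Section Model.
Context {U : universe} {M : class U} (HM : transitive_model M).

Let Mt : forall x y, M x -> y ∈ x -> M y := proj1 HM.

Lemma model_inhabited : exists x, M x.
Proof.
  destruct (zfc_infinity M (proj2 HM)) as (i & Hi & _); eauto.
Qed.

Lemma app_dom f a b : M f -> app f a b -> M a /\ M b.
Proof.
  intros Mf (p & Hp & s & Hs & t & Ht & _ & (Hat & Hbt & _) & _).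
  assert (M t) by eauto using Mt; eauto using Mt.
Qed.

Ltac solve_term := first [apply term_var | apply term_const; assumption].

Ltac solve_definable base :=
  cbn beta;
  lazymatch goal with
  | |- definable _ (fun _ => _ /\ _) =>
      apply def_and; solve_definable base
  | |- definable _ (fun _ => _ \/ _) =>
      apply def_or; solve_definable base
  | |- definable _ (fun _ => _ <-> _) =>
      apply def_iff; solve_definable base
  | |- definable _ (fun _ => ~ _) =>
      apply def_not; solve_definable base
  | |- definable _ (fun _ => exists _, _) =>
      first [apply def_ex | apply (def_bex M Mt); [solve_term|]];
      solve_definable base
  | |- definable _ (fun _ => forall _, _) =>
      first [apply def_all | apply (def_ball M Mt); [solve_term|] | apply def_imp];
      solve_definable base
  | |- definable _ (fun _ => _ ∈ _) =>
      apply def_mem; [exact model_inhabited|solve_term|solve_term]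
  | |- definable _ (fun _ => _ = _) =>
      apply def_eq; [exact model_inhabited|solve_term|solve_term]
  | |- _ => base tt
  end.

Lemma def_opair t s r :
  term M t -> term M s -> term M r ->
  definable M (fun e => opair (t e) (s e) (r e)).
Proof.
  apply def_term3; unfold opair, upair; solve_definable ltac:(fun _ => idtac).
Qed.

Lemma def_app t s r :
  term M t -> term M s -> term M r ->
  definable M (fun e => app (t e) (s e) (r e)).
Proof.
  apply def_term3; unfold app, opair, upair; solve_definable ltac:(fun _ => idtac).
Qed.

Lemma def_sub t s :
  term M t -> term M s -> definable M (fun e => sub (t e) (s e)).
Proof.
  apply def_term2; unfold sub; solve_definable ltac:(fun _ => idtac).
Qed.

Lemma def_functional t : term M t -> definable M (fun e => functional (t e)).
Proof.
  apply def_term1.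
  (* A pair belonging to a set of [M] has both coordinates in [M], so the quantifiers may be
     relativized. *)
  apply (def_ext M (fun e => forall x, M x -> forall a, M a -> forall b, M b ->
    app (e 0) x a -> app (e 0) x b -> a = b)).
  - solve_definable ltac:(fun _ => apply def_app; solve_term).
  - intros e He; split; [intros H x a b Ha Hb|intros H; intros; eapply H; eauto].
    destruct (app_dom _ _ _ (He 0) Ha), (app_dom _ _ _ (He 0) Hb); eauto.
Qed.

(* Equivalent to "|x| <= |y|" when y is an ordinal, but closed under subsets and
   images of x without any choice. *)
Definition covered (x y : U) : Prop :=
  exists f, M f /\ functional f /\
    forall a, a ∈ x -> exists b, b ∈ y /\ app f b a.

Lemma def_covered t s :
  term M t -> term M s -> definable M (fun e => covered (t e) (s e)).
Proof.
  apply def_term2; unfold covered.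
  solve_definable ltac:(fun _ =>
    first [apply def_app | apply def_functional]; solve_term).
Qed.

Ltac definability :=
  solve_definable ltac:(fun _ =>
    first [apply def_app | apply def_opair | apply def_sub | apply def_functional
          | apply def_covered | idtac]; try solve_term).

Lemma separation (P : U -> Prop) a :
  definable M (fun e => P (e 0)) -> M a ->
  exists b, M b /\ forall x, x ∈ b <-> x ∈ a /\ P x.
Proof.
  intros (p & g & Hg & H) Ha.
  (* The schema offers one variable followed by parameters. All free variables are sent to that one,
     which is harmless because [P] looks only at [e 0]. *)
  destruct (zfc_separation M (proj2 HM)
    (rename (interleave (fun _ => 0) (fun n => S n)) p) g Hg a Ha) as (b & Mb & Hb).
  exists b; split; auto.
  assert (K : forall x, M x -> x ∈ b <-> x ∈ a /\ P x).
  { intros x Mx; rewrite (Hb x Mx), (sat_rename M p _ _ (interleave (fun _ => x) g)).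
    - now rewrite (H (fun _ => x)).
    - apply interleave_all with (P := fun i y => scons x g i = y); auto. }
  intros x; split; intros Hx; apply K; auto.
  - eauto using Mt.
  - destruct Hx; eauto using Mt.
Qed.

Lemma upair_exists a b : M a -> M b -> exists p, M p /\ upair a b p.
Proof.
  intros Ma Mb; destruct (zfc_pairing M (proj2 HM) a Ma b Mb) as (p & Mp & H).
  exists p; split; auto; split; [|split].
  - apply H; auto.
  - apply H; auto.
  - intros z Hz; apply H; eauto using Mt.
Qed.

Lemma opair_exists a b : M a -> M b -> exists p, M p /\ opair a b p.
Proof.
  intros Ma Mb.
  destruct (upair_exists a a) as (s & Ms & Hs); auto.
  destruct (upair_exists a b) as (t & Mt' & Ht); auto.
  destruct (upair_exists s t) as (p & Mp & Hp); auto.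
  exists p; split; auto; exists s; split; [apply Hp|].
  exists t; split; [apply Hp|auto].
Qed.

Lemma union_exists x :
  M x -> exists u, M u /\ forall z, z ∈ u <-> exists y, y ∈ x /\ z ∈ y.
Proof.
  intros Mx; destruct (zfc_union M (proj2 HM) x Mx) as (u & Mu & H).
  exists u; split; auto; intros z; split.
  - intros Hz; apply H in Hz as (y & _ & Hy); eauto using Mt.
  - intros (y & Hy & Hz); assert (M y) by eauto using Mt.
    apply H; eauto using Mt.
Qed.

Lemma power_exists x :
  M x -> exists p, M p /\ forall z, z ∈ p <-> M z /\ sub z x.
Proof.
  intros Mx; destruct (zfc_power M (proj2 HM) x Mx) as (p & Mp & H).
  exists p; split; auto; intros z; split.
  - intros Hz; assert (Mz : M z) by eauto using Mt; split; auto.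
    intros y Hy; apply (H z Mz); eauto using Mt.
  - intros [Mz Hz]; apply H; auto; intros y _; apply Hz.
Qed.

Lemma opair_in_power x p q a b c :
  (forall z, z ∈ p <-> M z /\ sub z x) ->
  (forall z, z ∈ q <-> M z /\ sub z p) ->
  M x -> a ∈ x -> b ∈ x -> opair a b c -> c ∈ q.
Proof.
  intros Hp Hq Mx Ha Hb Hc.
  assert (Ma : M a) by eauto using Mt.
  assert (Mb : M b) by eauto using Mt.
  (* Nothing says yet that [c] lies in [M]; pairing in [M] yields such a pair, and by uniqueness it
     is [c]. *)
  destruct (opair_exists a b Ma Mb) as (c' & Mc & Hc').
  rewrite (opair_unique _ _ _ _ Hc Hc'); clear c Hc; rename c' into c.
  apply Hq; split; auto; intros z Hz; apply Hp; split; eauto using Mt.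
  destruct Hc' as (s & _ & t & _ & Hs & Ht & Hst).
  intros w Hw; destruct (proj2 (proj2 Hst) _ Hz) as [-> | ->].
  - destruct (proj2 (proj2 Hs) _ Hw) as [-> | ->]; auto.
  - destruct (proj2 (proj2 Ht) _ Hw) as [-> | ->]; auto.
Qed.

(** An upper bound for the product is enough, since separation cuts each relation out of it. *)
Lemma product_bound x y :
  M x -> M y ->
  exists c, M c /\ forall a b p, a ∈ x -> b ∈ y -> opair a b p -> p ∈ c.
Proof.
  intros Mx My.
  destruct (upair_exists x y) as (v & Mv & Hv); auto.
  destruct (union_exists v) as (u & Mu & Hu); auto.
  destruct (power_exists u) as (p & Mp & Hp); auto.
  destruct (power_exists p) as (q & Mq & Hq); auto.
  exists q; split; auto; intros a b c Ha Hb.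
  apply (opair_in_power u p q); auto; apply Hu.
  - exists x; split; auto; apply Hv.
  - exists y; split; auto; apply Hv.
Qed.

Lemma relation_exists (R : U -> U -> Prop) x y :
  definable M (fun e => R (e 0) (e 1)) -> M x -> M y ->
  exists f, M f /\ rel_on f x y /\
    forall a b, app f a b <-> a ∈ x /\ b ∈ y /\ R a b.
Proof.
  intros HR Mx My; destruct (product_bound x y) as (c & Mc & Hc); auto.
  destruct (separation (fun p => exists a, a ∈ x /\ exists b, b ∈ y /\
    opair a b p /\ R a b) c) as (f & Mf & Hf); auto.
  { definability.
    exact (def_reindex M _ (fun n => match n with 0 => 1 | _ => 0 end) HR). }
  exists f; split; [|split]; auto.
  - intros p Hp; apply Hf in Hp as (_ & a & Ha & b & Hb & Hp & _); eauto 6.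
  - intros a b; split.
    + intros (p & Hp & Hab); apply Hf in Hp as (_ & a' & Ha & b' & Hb & Hp & HR').
      destruct (opair_inj _ _ _ _ _ Hab Hp) as [-> ->]; auto.
    + intros (Ha & Hb & H).
      destruct (opair_exists a b) as (p & Mp & Hp); eauto using Mt.
      exists p; split; auto; apply Hf; eauto 10.
Qed.

(** * Absoluteness of pairs and application; choice functions *)

Lemma upair_in_iff a b p :
  M a -> M b -> M p -> upair_in M a b p <-> upair a b p.
Proof.
  intros Ma Mb Mp; split.
  - intros H; split; [|split]; [apply H; auto|apply H; auto|].
    intros z Hz; apply H; eauto using Mt.
  - intros (Ha & Hb & H) z Mz; split; auto; intros [->| ->]; auto.
Qed.

Lemma opair_in_iff a b p :
  M a -> M b -> M p -> opair_in M a b p <-> opair a b p.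
Proof.
  intros Ma Mb Mp; split.
  - intros (s & Ms & t & Mt' & Hs & Ht & Hp).
    apply upair_in_iff in Hs, Ht, Hp; auto.
    exists s; split; [apply Hp|exists t; split; [apply Hp|auto]].
  - intros (s & Hsp & t & Htp & Hs & Ht & Hp).
    assert (M s) by eauto using Mt; assert (M t) by eauto using Mt.
    exists s; split; auto; exists t; split; auto.
    rewrite !upair_in_iff; auto.
Qed.

Lemma app_in_iff f a b :
  M f -> M a -> M b -> app_in M f a b <-> app f a b.
Proof.
  intros Mf Ma Mb; split.
  - intros (p & Mp & Hp & Hpf); apply opair_in_iff in Hp; auto; exists p; auto.
  - intros (p & Hpf & Hp); assert (M p) by eauto using Mt.
    exists p; split; auto; split; auto; now apply opair_in_iff.
Qed.

Lemma sub_in_iff x y : M x -> sub_in M x y <-> sub x y.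
Proof.
  intros Mx; split; intros H z; [|auto].
  intros Hz; apply H; eauto using Mt.
Qed.

(** The axiom of choice is applied to the fibres of [R], each stored as a set of pairs with a common
    first coordinate. The set of chosen pairs is then already the required function. *)
Lemma choice_exists (R : U -> U -> Prop) x y :
  definable M (fun e => R (e 0) (e 1)) -> M x -> M y ->
  (forall a, a ∈ x -> exists b, b ∈ y /\ R a b) ->
  exists f, M f /\ functional f /\ rel_on f x y /\
    (forall a, a ∈ x -> exists b, app f a b) /\
    (forall a b, app f a b -> a ∈ x /\ b ∈ y /\ R a b).
Proof.
  intros HR Mx My Hex.
  destruct (relation_exists R x y HR Mx My) as (r & Mr & Hr & Happ).
  destruct (power_exists r Mr) as (q & Mq & Hq).
  (* A member [t] of [X] consists of exactly the pairs of [r] that start with one [a]. *)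
  destruct (separation (fun t => exists a, a ∈ x /\
    (forall p, p ∈ t -> exists b, b ∈ y /\ opair a b p) /\
    forall p, p ∈ r -> (exists b, b ∈ y /\ opair a b p) -> p ∈ t) q)
    as (X & MX & HX); auto; [definability|].
  destruct (zfc_choice M (proj2 HM) X MX) as (c & Mc & [_ Hc] & Hmem).
  { intros t Mt' Ht; apply HX in Ht as (Htq & a & Ha & _ & Ht).
    destruct (Hex a Ha) as (b & Hb & Hab).
    destruct (proj2 (Happ a b)) as (p & Hp & Hp'); auto.
    exists p; split; eauto using Mt. }
  assert (Hcapp : forall t p, M t -> M p -> app_in M c t p <-> app c t p).
  { intros; now apply app_in_iff. }
  destruct (separation (fun p => exists t, t ∈ X /\ app c t p) r) as (f & Mf & Hf);
    auto; [definability|].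
  exists f; split; [|split; [|split; [|split]]]; auto.
  - intros a b b' (p & Hp & Hab) (p' & Hp' & Hab').
    apply Hf in Hp as (Hpr & t & HtX & Htp), Hp' as (Hpr' & t' & HtX' & Htp').
    assert (Mt1 : M t) by eauto using Mt.
    assert (Mt2 : M t') by eauto using Mt.
    destruct (Hc t Mt1 HtX) as (p0 & _ & _ & Hu).
    assert (Mp : M p) by eauto using Mt.
    assert (Mp' : M p') by eauto using Mt.
    assert (Hpt : p ∈ t) by (apply Hmem; auto; now apply Hcapp).
    assert (Hpt' : p' ∈ t') by (apply Hmem; auto; now apply Hcapp).
    (* Both chosen pairs start with [a], so they come from the same fibre, from which only one pair
       is chosen. *)
    enough (t = t') as <-.
    { assert (p = p') as <-.
      { transitivity p0; [|symmetry]; apply Hu; auto; now apply Hcapp. }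
      now destruct (opair_inj _ _ _ _ _ Hab Hab'). }
    apply HX in HtX as (Htq & d & Hd & Hd1 & Hd2).
    apply HX in HtX' as (Htq' & d' & Hd' & Hd1' & Hd2').
    assert (d = a) as -> by (destruct (Hd1 _ Hpt) as (? & _ & K);
      now destruct (opair_inj _ _ _ _ _ K Hab)).
    assert (d' = a) as -> by (destruct (Hd1' _ Hpt') as (? & _ & K);
      now destruct (opair_inj _ _ _ _ _ K Hab')).
    apply Hq in Htq as [_ Htr], Htq' as [_ Htr'].
    apply sub_antisym; intros z Hz; auto.
  - intros p Hp; apply Hf in Hp as [Hp _]; auto.
  - intros a Ha.
    destruct (separation (fun p => exists b, b ∈ y /\ opair a b p) r)
      as (t & Mt1 & Ht); auto.
    { assert (M a) by eauto using Mt; definability. }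
    assert (HtX : t ∈ X).
    { apply HX; split.
      - apply Hq; split; auto; intros p Hp; now apply Ht.
      - exists a; split; auto; split.
        + intros p Hp; now apply Ht.
        + intros p Hp Hb; now apply Ht. }
    destruct (Hc t Mt1 HtX) as (p & Mp & Hp & _).
    assert (Hpt : p ∈ t) by now apply (Hmem t Mt1).
    apply Ht in Hpt as (Hpr & b & Hb & Hab).
    exists b, p; split; auto; apply Hf; split; auto.
    exists t; split; auto; now apply Hcapp.
  - intros a b (p & Hp & Hab); apply Hf in Hp as [Hp _].
    apply Happ; exists p; auto.
Qed.

(** * Cardinalities *)

Lemma covered_mono x x' y y' :
  sub x' x -> sub y y' -> covered x y -> covered x' y'.
Proof.
  intros Hx Hy (f & Mf & Hf & H); exists f; split; [|split]; auto.
  intros a Ha; destruct (H a (Hx a Ha)) as (b & Hb & Hab); eauto.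
Qed.

Lemma covered_intro (R : U -> U -> Prop) x y :
  definable M (fun e => R (e 0) (e 1)) -> M x -> M y ->
  (forall b a a', b ∈ y -> a ∈ x -> a' ∈ x -> R b a -> R b a' -> a = a') ->
  (forall a, a ∈ x -> exists b, b ∈ y /\ R b a) ->
  covered x y.
Proof.
  intros HR Mx My Hfun Htot.
  destruct (relation_exists R y x HR My Mx) as (f & Mf & _ & Hf).
  exists f; split; [|split]; auto.
  - intros b a a' H H'; apply Hf in H as (Hb & Ha & H), H' as (_ & Ha' & H').
    now apply (Hfun b).
  - intros a Ha; destruct (Htot a Ha) as (b & Hb & Hab).
    exists b; split; auto; now apply Hf.
Qed.

Lemma covered_trans x y z :
  M x -> M y -> M z -> covered x y -> covered y z -> covered x z.
Proof.
  intros Mx My Mz (f & Mf & Ff & Hf) (g & Mg & Fg & Hg).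
  apply (covered_intro (fun c a => exists b, b ∈ y /\ app g c b /\ app f b a)); auto.
  - definability.
  - intros c a a' _ _ _ (b & Hb & Hcb & Hba) (b' & _ & Hcb' & Hba').
    rewrite (Fg _ _ _ Hcb' Hcb) in Hba'; now apply (Ff b).
  - intros a Ha; destruct (Hf a Ha) as (b & Hb & Hba).
    destruct (Hg b Hb) as (c & Hc & Hcb); eauto 6.
Qed.

Record bijection (f x y : U) : Prop := {
  bij_rel : rel_on f x y;
  bij_fun : functional f;
  bij_inj : forall a b c, app f a c -> app f b c -> a = b;
  bij_total : forall a, a ∈ x -> exists b, app f a b;
  bij_onto : forall b, b ∈ y -> exists a, app f a b
}.

(** * Transitive collapse of a set of ordinals *)

Section Collapse.
Variables (beta I : U).
Hypotheses (Hbeta : ordinal beta) (Mbeta : M beta) (MI : M I) (HI : sub I beta).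

(** A set [h] may take several values at one index; the order condition is then imposed on all of
    those lying in [beta]. *)
Definition increasing (h : U) : Prop :=
  (forall i, i ∈ I -> exists j, j ∈ beta /\ app h i j) /\
  (forall i, i ∈ I -> forall i', i' ∈ I -> i ∈ i' ->
   forall j, j ∈ beta -> forall j', j' ∈ beta -> app h i j -> app h i' j' -> j ∈ j').

Definition reachable (i j : U) : Prop :=
  j ∈ beta /\ exists h, M h /\ increasing h /\ app h i j.

(* The pointwise minimum of all increasing maps is the transitive collapse of I:
   this replaces the usual recursion. *)
Definition collapse (i j : U) : Prop :=
  reachable i j /\ forall j', j' ∈ j -> ~ reachable i j'.

Lemma def_collapse t s :
  term M t -> term M s -> definable M (fun e => collapse (t e) (s e)).
Proof.
  apply def_term2; unfold collapse, reachable, increasing; definability.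
Qed.

Lemma reachable_collapse i j :
  reachable i j -> exists j', collapse i j' /\ (j' = j \/ j' ∈ j).
Proof.
  intros Hr; destruct (mem_minimal (fun k => reachable i k /\ (k = j \/ k ∈ j)))
    as (k & [Hk Hkj] & Hmin); eauto.
  exists k; split; auto; split; auto.
  intros l Hl Hrl; apply (Hmin l Hl); split; auto.
  right; destruct Hkj as [->|Hkj]; auto.
  assert (ordinal j) by exact (ordinal_mem _ _ Hbeta (proj1 Hr)).
  now apply (ordinal_sub j H k).
Qed.

Lemma collapse_unique i j j' : collapse i j -> collapse i j' -> j = j'.
Proof.
  intros [Hr Hm] [Hr' Hm'].
  destruct (ordinal_total beta Hbeta j j' (proj1 Hr) (proj1 Hr')) as [H|[H|H]]; auto.
  - now destruct (Hm' j).
  - now destruct (Hm j').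
Qed.

(** The identity on [I] is increasing with values in [beta], so some value is reachable at [i],
    hence a least one. *)
Lemma collapse_total i : i ∈ I -> exists j, collapse i j.
Proof.
  intros Hi.
  destruct (relation_exists (fun a b => a = b) I beta) as (h & Mh & _ & Hh); auto;
    [definability|].
  destruct (reachable_collapse i i) as (j & Hj & _); eauto.
  split; auto; exists h; split; [|split]; auto; [split|].
  - intros k Hk; exists k; split; auto; apply Hh; auto.
  - intros k _ k' _ Hkk' j _ j' _ Hj Hj'.
    apply Hh in Hj as (_ & _ & <-), Hj' as (_ & _ & <-); auto.
  - apply Hh; auto.
Qed.

(** A map that attains the minimum [j'] at [i'] takes a value below [j'] at [i], and the minimum at
    [i] is no larger than this value. *)
Lemma collapse_increasing i i' j j' :
  i ∈ I -> i' ∈ I -> i ∈ i' -> collapse i j -> collapse i' j' -> j ∈ j'.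
Proof.
  intros Hi Hi' Hii' Hj [Hr' Hm']; pose proof Hr' as (Hj' & h & Mh & Hh & Happ).
  destruct (proj1 Hh i Hi) as (k & Hk & Hik).
  assert (Hkj' : k ∈ j') by exact (proj2 Hh i Hi i' Hi' Hii' k Hk j' Hj' Hik Happ).
  destruct (reachable_collapse i k) as (l & Hl & Hlk).
  { split; eauto. }
  rewrite (collapse_unique i j l Hj Hl).
  destruct Hlk as [->|Hlk]; auto.
  now apply (ordinal_sub j' (ordinal_mem _ _ Hbeta Hj') k).
Qed.

Lemma collapse_injective i i' j :
  i ∈ I -> i' ∈ I -> collapse i j -> collapse i' j -> i = i'.
Proof.
  intros Hi Hi' Hj Hj'.
  destruct (ordinal_total beta Hbeta i i') as [H|[H|H]]; auto;
    destruct (mem_irrefl j); eauto using collapse_increasing.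
Qed.

(* Otherwise lowering one value of the collapse to the gap j would give a smaller
   increasing map. *)
Lemma collapse_range i j k :
  i ∈ I -> collapse i k -> j ∈ k -> exists i', i' ∈ I /\ collapse i' j.
Proof.
  intros Hi Hk Hj; apply NNPP; intros N.
  (* At indices below [i0] the collapse neither exceeds [j], by minimality, nor equals it, by [N];
     so changing the value at [i0] to [j] keeps the map increasing. *)
  destruct (mem_minimal (fun i => i ∈ I /\ exists k, collapse i k /\ j ∈ k))
    as (i0 & (Hi0 & k0 & Hk0 & Hj0) & Hmin); [eauto|].
  assert (Hk0b : k0 ∈ beta) by apply Hk0.
  assert (Hjb : j ∈ beta) by exact (ordinal_sub _ Hbeta k0 Hk0b j Hj0).
  assert (Mi0 : M i0) by eauto using Mt.
  assert (Mj : M j) by eauto using Mt.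
  destruct (relation_exists (fun a b => (a = i0 /\ b = j) \/ (a <> i0 /\ collapse a b))
    I beta) as (h & Mh & _ & Hh); auto.
  { definability; apply def_collapse; apply term_var. }
  apply (proj2 Hk0 j Hj0); split; auto; exists h; split; [|split]; auto; [split|].
  - intros a Ha; destruct (classic (a = i0)) as [->|Ne].
    + exists j; split; auto; apply Hh; auto.
    + destruct (collapse_total a Ha) as (b & Hb).
      assert (b ∈ beta) by apply Hb.
      exists b; split; auto; apply Hh; auto.
  - intros a Ha a' Ha' Haa' b Hb b' Hb' H H'.
    apply Hh in H as (_ & _ & H), H' as (_ & _ & H').
    destruct H as [[-> ->]|[Ne H]], H' as [[-> ->]|[Ne' H']].
    + now destruct (mem_irrefl i0).
    + assert (k0 ∈ b') by eauto using collapse_increasing.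
      now apply (ordinal_sub b' (ordinal_mem _ _ Hbeta Hb') k0).
    + destruct (ordinal_total beta Hbeta b j) as [K|[K|K]]; auto.
      * subst b; destruct N; eauto.
      * destruct (Hmin a Haa'); eauto.
    + eauto using collapse_increasing.
  - apply Hh; auto.
Qed.

End Collapse.

(** Keeping only the least index of each element of [x] makes the surjection injective. The set [I]
    of these indices is then collapsed, and minimality of [beta] forces the collapse to be onto. *)
Lemma covered_bijection x beta :
  ordinal beta -> M beta -> M x -> covered x beta ->
  (forall b, b ∈ beta -> ~ covered x b) ->
  exists f, M f /\ bijection f x beta.
Proof.
  intros Hb Mb Mx (f & Mf & Ff & Hf) Hmin.
  destruct (separation (fun i => exists a, a ∈ x /\ app f i a /\
    forall j, j ∈ beta -> app f j a -> ~ j ∈ i) beta) as (I & MI & HI);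
    auto; [definability|].
  assert (HIb : sub I beta) by (intros i Hi; now apply HI).
  assert (Htot : forall a, a ∈ x -> exists i, i ∈ I /\ app f i a).
  { intros a Ha; destruct (mem_minimal (fun i => i ∈ beta /\ app f i a))
      as (i & [Hi Hia] & Hm); auto.
    exists i; split; auto; apply HI; split; auto.
    exists a; split; [|split]; auto.
    intros j Hj Hja Hji; exact (Hm j Hji (conj Hj Hja)). }
  assert (Hinj : forall i i' a, i ∈ I -> i' ∈ I -> app f i a -> app f i' a -> i = i').
  { intros i i' a Hi Hi' Ha Ha'.
    apply HI in Hi as (Hi & c & Hc & Hic & Hm), Hi' as (Hi' & c' & Hc' & Hic' & Hm').
    rewrite (Ff _ _ _ Hic Ha) in Hm; rewrite (Ff _ _ _ Hic' Ha') in Hm'.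
    destruct (ordinal_total beta Hb i i') as [H|[H|H]]; auto.
    - now destruct (Hm' i).
    - now destruct (Hm i'). }
  assert (Hdef : definable M
    (fun e => exists i, i ∈ I /\ collapse beta I i (e 0) /\ app f i (e 1))).
  { definability; apply def_collapse; auto; apply term_var. }
  assert (Honto : forall j, j ∈ beta -> exists i, i ∈ I /\ collapse beta I i j).
  { intros j Hj; apply NNPP; intros N; apply (Hmin j Hj).
    apply (covered_intro (fun k a => exists i, i ∈ I /\ collapse beta I i k /\ app f i a));
      eauto using Mt.
    - intros k a a' _ _ _ (i & Hi & Hik & Ha) (i' & Hi' & Hik' & Ha').
      rewrite (collapse_injective beta I Hb HIb i' i k) in Ha'; auto.
      now apply (Ff i).
    - intros a Ha; destruct (Htot a Ha) as (i & Hi & Hia).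
      destruct (collapse_total beta I Hb Mb MI HIb i Hi) as (k & Hk).
      exists k; split; eauto.
      destruct (ordinal_total beta Hb k j) as [H|[H|H]]; auto.
      + apply Hk.
      + subst k; destruct N; eauto.
      + destruct N; eapply collapse_range; eauto. }
  destruct (relation_exists (fun a k => exists i, i ∈ I /\ collapse beta I i k /\ app f i a)
    x beta) as (g & Mg & Hrel & Hg); auto.
  { exact (def_reindex M _ (fun n => match n with 0 => 1 | _ => 0 end) Hdef). }
  exists g; split; auto; split; auto.
  - intros a k k' H H'.
    apply Hg in H as (_ & _ & i & Hi & Hik & Hia), H' as (_ & _ & i' & Hi' & Hik' & Hia').
    rewrite (Hinj i' i a) in Hik' by auto.
    eapply collapse_unique; eauto.
  - intros a a' k H H'.
    apply Hg in H as (_ & _ & i & Hi & Hik & Hia), H' as (_ & _ & i' & Hi' & Hik' & Hia').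
    rewrite (collapse_injective beta I Hb HIb i' i k) in Hia' by auto.
    now apply (Ff i).
  - intros a Ha; destruct (Htot a Ha) as (i & Hi & Hia).
    destruct (collapse_total beta I Hb Mb MI HIb i Hi) as (k & Hk).
    exists k; apply Hg; split; [|split]; eauto; apply Hk.
  - intros k Hk; destruct (Honto k Hk) as (i & Hi & Hik).
    pose proof Hi as Hi'; apply HI in Hi' as (_ & a & Ha & Hia & _).
    exists a; apply Hg; eauto 6.
Qed.

(** * Relativized cardinality in terms of coverings *)

Lemma bijection_in_iff f x y :
  M f -> M x -> M y -> bijection_in M f x y <-> bijection f x y.
Proof.
  intros Mf Mx My; split.
  - intros (((Hrel & Htot) & Hval) & Hinj & Honto).
    assert (Hv : forall a b, app f a b -> M a /\ M b /\ app_in M f a b).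
    { intros a b H; destruct (app_dom f a b) as [Ma Mb]; auto.
      split; [|split]; auto; now apply app_in_iff. }
    split.
    + intros p Hp; assert (Mp : M p) by eauto using Mt.
      destruct (Hrel p Mp Hp) as (a & Ma & b & Mb & Ha & Hab).
      exists a, b; split; [|split]; auto.
      * apply (Hval a Ma b Mb); exists p; auto.
      * now apply opair_in_iff.
    + intros a b c Hb Hc.
      destruct (Hv a b Hb) as (Ma & Mb & Hb'), (Hv a c Hc) as (_ & Mc & Hc').
      assert (Ha : a ∈ x).
      { destruct Hb as (p & Hp & Hab); assert (Mp : M p) by eauto using Mt.
        destruct (Hrel p Mp Hp) as (a' & Ma' & b' & Mb' & Ha & H).
        apply opair_in_iff in H; auto.
        now destruct (opair_inj _ _ _ _ _ Hab H) as [-> _]. }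
      destruct (Htot a Ma Ha) as (d & _ & _ & Hd).
      transitivity d; [|symmetry]; auto.
    + intros a b c Hb Hc.
      destruct (Hv a c Hb) as (Ma & Mb & Hb'), (Hv b c Hc) as (? & Mc & Hc').
      now apply (Hinj a Ma b H c Mb).
    + intros a Ha; assert (Ma : M a) by eauto using Mt.
      destruct (Htot a Ma Ha) as (b & Mb & Hb & _).
      exists b; now apply app_in_iff.
    + intros b Hb; assert (Mb : M b) by eauto using Mt.
      destruct (Honto b Mb Hb) as (a & Ma & Ha).
      exists a; now apply app_in_iff.
  - intros [Hrel Hfun Hinj Htot Honto]; split; [split; [split|]|split].
    + intros p Mp Hp; destruct (Hrel p Hp) as (a & b & Ha & Hb & H).
      assert (M a) by eauto using Mt; assert (M b) by eauto using Mt.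
      exists a; split; auto; exists b; split; auto; split; auto.
      now apply opair_in_iff.
    + intros a Ma Ha; destruct (Htot a Ha) as (b & Hb).
      assert (Mb : M b) by now apply (app_dom f a b).
      exists b; split; auto; split; [now apply app_in_iff|].
      intros c Mc Hc; apply app_in_iff in Hc; auto; now apply (Hfun a).
    + intros a Ma b Mb H; apply app_in_iff in H; auto.
      now apply (rel_on_app f x y a b).
    + intros a Ma b Mb c Mc H H'; apply app_in_iff in H, H'; auto.
      now apply (Hinj a b c).
    + intros b Mb Hb; destruct (Honto b Hb) as (a & Ha).
      assert (M a) by now apply (app_dom f a b).
      exists a; split; auto; now apply app_in_iff.
Qed.

Lemma ordinal_in_iff x : M x -> ordinal_in M x <-> ordinal x.
Proof.
  intros Mx; split.
  - intros [Ht _ _ Htot _]; split.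
    + intros y Hy; assert (M y) by eauto using Mt.
      apply sub_in_iff; auto.
    + intros y z Hy Hz; apply Htot; eauto using Mt.
  - intros Hx; split.
    + intros y My Hy z _; now apply (ordinal_sub x Hx).
    + intros y _ _; apply mem_irrefl.
    + intros y _ z _ w _ _ _ Hw Hyz Hzw.
      now apply (ordinal_sub w (ordinal_mem _ _ Hx Hw) z).
    + intros y _ z _; apply (ordinal_total x Hx).
    + intros s Ms Hs (y & My & Hy).
      destruct (mem_minimal (fun z => z ∈ s)) as (z & Hz & Hm); eauto.
      exists z; split; eauto using Mt; split; auto.
      intros w Mw Hw.
      destruct (ordinal_total x Hx z w) as [H|[H|H]]; auto.
      * apply Hs; eauto using Mt.
      * now destruct (Hm w).
Qed.

Lemma bijection_covered f x y :
  M f -> M x -> M y -> bijection f x y -> covered x y.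
Proof.
  intros Mf Mx My [Hrel Hfun Hinj Htot Honto].
  apply (covered_intro (fun b a => app f a b)); auto.
  - definability.
  - intros b a a' _ _ _; apply Hinj.
  - intros a Ha; destruct (Htot a Ha) as (b & Hb); exists b; split; auto.
    now apply (rel_on_app f x y a b).
Qed.

(** The relation |x| < k in surjective form; [card_lt_in_iff] justifies it when [k] is an
    ordinal. *)
Definition small (k x : U) : Prop := exists b, b ∈ k /\ covered x b.

(** The least ordinal covering [x] is in bijection with [x]. It is a cardinal, since a bijection
    from one of its members onto it would let that member cover [x]. *)
Lemma card_lt_in_iff k x :
  ordinal k -> M k -> M x -> card_lt_in M x k <-> small k x.
Proof.
  intros Hk Mk Mx; split.
  - intros (m & Mm & _ & (f & Mf & Hf) & Hm); exists m; split; auto.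
    apply bijection_in_iff in Hf; auto; now apply (bijection_covered f).
  - intros Hx; apply mem_minimal in Hx as (b & [Hb Hc] & Hmin).
    assert (Mb : M b) by eauto using Mt.
    assert (Ob : ordinal b) by now apply (ordinal_mem k).
    assert (Hmin' : forall c, c ∈ b -> ~ covered x c).
    { intros c Hcb H; apply (Hmin c Hcb); split; auto.
      now apply (ordinal_sub k Hk b). }
    destruct (covered_bijection x b Ob Mb Mx Hc Hmin') as (f & Mf & Hf).
    exists b; split; [|split; [split|split]]; auto.
    + now apply ordinal_in_iff.
    + intros c Mc Hcb (g & Mg & Hg); apply bijection_in_iff in Hg; auto.
      apply (Hmin' c Hcb), (covered_intro
        (fun u a => exists j, j ∈ b /\ app g u j /\ app f a j)); auto.
      * definability.
      * intros u a a' _ _ _ (j & _ & Hj & Ha) (j' & _ & Hj' & Ha').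
        rewrite (bij_fun _ _ _ Hg _ _ _ Hj' Hj) in Ha'.
        now apply (bij_inj _ _ _ Hf a a' j).
      * intros a Ha; destruct (bij_total _ _ _ Hf a Ha) as (j & Hj).
        assert (Hjb : j ∈ b) by (apply (rel_on_app f x b a j); auto; apply Hf).
        destruct (bij_onto _ _ _ Hg j Hjb) as (u & Hu).
        exists u; split; eauto; apply (rel_on_app g c b u j); auto; apply Hg.
    + exists f; split; auto; now apply bijection_in_iff.
Qed.

(** * Smallness of images, power sets and unions *)

Lemma small_covered k x y :
  ordinal k -> M k -> M x -> M y -> covered x y -> small k y -> small k x.
Proof.
  intros Hk Mk Mx My Hxy (b & Hb & Hyb); exists b; split; auto.
  apply (covered_trans x y b); eauto using Mt.
Qed.

Lemma small_sub k x y : sub x y -> small k y -> small k x.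
Proof.
  intros Hxy (b & Hb & Hyb); exists b; split; auto.
  apply (covered_mono y x b b); auto; now intros z.
Qed.

(** A subset of [x] is recovered from the set of its indices in [m], so the power set of [m] covers
    that of [x], and the strong limit property bounds the former. *)
Lemma small_power k x p :
  ordinal k -> M k -> M x -> M p -> strong_limit_in M k ->
  (forall z, z ∈ p <-> M z /\ sub z x) ->
  small k x -> small k p.
Proof.
  intros Hk Mk Mx Mp Hlim Hp (m & Hm & f & Mf & Ff & Hf).
  assert (Mm : M m) by eauto using Mt.
  destruct (power_exists m Mm) as (q & Mq & Hq).
  apply (small_covered k p q); auto.
  - apply (covered_intro (fun s t => (forall a, a ∈ t -> exists i, i ∈ s /\ app f i a) /\
      forall a, a ∈ x -> (exists i, i ∈ s /\ app f i a) -> a ∈ t)); auto.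
    + definability.
    + intros s t t' _ Ht Ht' [H1 H2] [H1' H2'].
      apply Hp in Ht as [_ Ht], Ht' as [_ Ht'].
      apply sub_antisym; intros a Ha; auto.
    + intros t Ht; apply Hp in Ht as [Mt' Ht].
      destruct (separation (fun i => exists a, a ∈ t /\ app f i a) m)
        as (s & Ms & Hs); auto; [definability|].
      exists s; split; [|split].
      * apply Hq; split; auto; intros i Hi; now apply Hs.
      * intros a Ha; destruct (Hf a (Ht a Ha)) as (i & Hi & Hia).
        exists i; split; auto; apply Hs; eauto.
      * intros a Ha (i & Hi & Hia); apply Hs in Hi as (_ & b & Hb & Hib).
        now rewrite (Ff _ _ _ Hia Hib).
  - apply card_lt_in_iff; auto; apply (Hlim m Mm Hm q Mq).
    intros z Mz; rewrite Hq, sub_in_iff by auto; tauto.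
Qed.

(** Regularity is applied to the map from [x] to [k] that sends an index of [y] to the least ordinal
    covering [y]. *)
Lemma small_bound k z x g :
  ordinal k -> M k -> regular_in M k -> M z -> M g -> functional g -> M x -> x ∈ k ->
  (forall y, y ∈ z -> exists i, i ∈ x /\ app g i y) ->
  (forall y, y ∈ z -> small k y) ->
  exists b, b ∈ k /\ forall y, y ∈ z -> covered y b.
Proof.
  intros Hk Mk Hreg Mz Mg Fg Mx Hx Hg Hsm.
  pose (least := fun y m => covered y m /\ forall m', m' ∈ m -> ~ covered y m').
  assert (Hleast : forall y, y ∈ z -> exists m, m ∈ k /\ least y m).
  { intros y Hy; destruct (mem_minimal _ (Hsm y Hy)) as (m & [Hm Hc] & Hmin).
    exists m; split; auto; split; auto; intros m' Hm' Hc'.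
    apply (Hmin m' Hm'); split; auto; now apply (ordinal_sub k Hk m). }
  (* Indices of no member of z get the junk value i itself. *)
  destruct (relation_exists (fun i m => (exists y, y ∈ z /\ app g i y /\ least y m) \/
      (~ (exists y, y ∈ z /\ app g i y) /\ m = i)) x k) as (h & Mh & Hrel & Hh); auto.
  { unfold least; definability. }
  destruct (Hreg x Mx Hx h Mh) as (b & Mb & Hb & Hbound).
  { split; [split|].
    - intros p Mp Hp; destruct (Hrel p Hp) as (a & c & Ha & Hc & Hac).
      assert (M a) by eauto using Mt; assert (M c) by eauto using Mt.
      exists a; split; auto; exists c; split; auto; split; auto.
      now apply opair_in_iff.
    - intros i Mi Hi.
      assert (Hex : exists m, app h i m).
      { destruct (classic (exists y, y ∈ z /\ app g i y)) as [(y & Hy & Hiy)|N].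
        - destruct (Hleast y Hy) as (m & Hm & Hl); exists m; apply Hh; eauto 8.
        - exists i; apply Hh; split; [|split]; auto.
          now apply (ordinal_sub k Hk x). }
      destruct Hex as (m & Hm).
      assert (Mm : M m) by now apply (app_dom h i m).
      exists m; split; auto; split; [now apply app_in_iff|].
      intros n Mn Hn; apply app_in_iff in Hn; auto.
      apply Hh in Hm as (_ & Hmk & Hm), Hn as (_ & Hnk & Hn).
      destruct Hm as [(y & Hy & Hiy & Hl)|[N ->]],
        Hn as [(y' & Hy' & Hiy' & Hl')|[N' ->]]; auto.
      + rewrite (Fg _ _ _ Hiy' Hiy) in Hl'.
        destruct (ordinal_total k Hk m n) as [H|[H|H]]; auto.
        * destruct (proj2 Hl' m H); apply Hl.
        * destruct (proj2 Hl n H); apply Hl'.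
      + destruct N'; eauto.
      + destruct N; eauto.
    - intros i Mi m Mm H; apply app_in_iff in H; auto; now apply Hh in H. }
  exists b; split; auto; intros y Hy.
  destruct (Hg y Hy) as (i & Hi & Hiy), (Hleast y Hy) as (m & Hm & Hl).
  assert (Him : app h i m) by (apply Hh; eauto 8).
  destruct (app_dom h i m) as [Mi Mm]; auto.
  apply (covered_mono y y m b); [now intros w| |apply Hl].
  apply (ordinal_sub b (ordinal_mem _ _ Hk Hb)).
  apply (Hbound i Mi m Mm); now apply app_in_iff.
Qed.

(* The product of two ordinals below k is contained in a double power set of
   their maximum, whence the strong limit hypothesis. *)
Lemma small_union k z u :
  ordinal k -> M k -> regular_in M k -> strong_limit_in M k ->
  M z -> M u -> (forall a, a ∈ u <-> exists y, y ∈ z /\ a ∈ y) ->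
  small k z -> (forall y, y ∈ z -> small k y) -> small k u.
Proof.
  intros Hk Mk Hreg Hlim Mz Mu Hu (x & Hx & g & Mg & Fg & Hg) Hsm.
  assert (Mx : M x) by eauto using Mt.
  destruct (small_bound k z x g) as (b & Hb & Hcov); auto.
  assert (Mb : M b) by eauto using Mt.
  destruct (product_bound b u) as (c & Mc & Hc); auto.
  destruct (power_exists c) as (pc & Mpc & Hpc); auto.
  destruct (choice_exists (fun y f => functional f /\
      forall a, a ∈ y -> exists j, j ∈ b /\ app f j a) z pc)
    as (G & MG & FG & _ & Gtot & HG); auto.
  { definability. }
  (* A covering map may contain irrelevant pairs; cutting it down to pairs from [b] and [u] puts it
     in the fixed set [pc], from which choice can select. *)
  { intros y Hy; destruct (Hcov y Hy) as (f & Mf & Ff & Hf).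
    destruct (relation_exists (fun j a => app f j a) b u) as (f' & Mf' & Hrel & Hf');
      auto; [definability|].
    exists f'; split; [|split].
    - apply Hpc; split; auto; intros p Hp.
      destruct (Hrel p Hp) as (j & a & Hj & Ha & Hja); eauto.
    - intros j a a' H H'; apply Hf' in H as (_ & _ & H), H' as (_ & _ & H').
      now apply (Ff j).
    - intros a Ha; destruct (Hf a Ha) as (j & Hj & Hja).
      exists j; split; auto; apply Hf'; split; [|split]; auto.
      apply Hu; eauto. }
  assert (Hmax : exists d, d ∈ k /\ sub x d /\ sub b d).
  { destruct (ordinal_total k Hk x b) as [H|[H|H]]; auto.
    - exists b; split; [|split]; auto; [|now intros w].
      now apply (ordinal_sub b (ordinal_mem _ _ Hk Hb)).
    - subst b; exists x; split; [|split]; auto; now intros w.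
    - exists x; split; [|split]; auto; [now intros w|].
      now apply (ordinal_sub x (ordinal_mem _ _ Hk Hx)). }
  destruct Hmax as (d & Hd & Hxd & Hbd).
  assert (Md : M d) by eauto using Mt.
  destruct (power_exists d) as (p & Mp & Hp); auto.
  destruct (power_exists p) as (q & Mq & Hq); auto.
  apply (small_covered k u q); auto.
  (* The pair of [i] and [j] is sent to the element with index [j] in the member of [z] with index
     [i]. *)
  - apply (covered_intro (fun w a => exists i, i ∈ x /\ exists j, j ∈ b /\
      opair i j w /\ exists y, y ∈ z /\ app g i y /\
      exists f, M f /\ app G y f /\ app f j a)); auto.
    + definability.
    + intros w a a' _ _ _ (i & _ & j & _ & Hij & y & _ & Hiy & f & _ & Hyf & Ha)
        (i' & _ & j' & _ & Hij' & y' & _ & Hiy' & f' & _ & Hyf' & Ha').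
      destruct (opair_inj _ _ _ _ _ Hij Hij') as [<- <-].
      rewrite (Fg _ _ _ Hiy' Hiy) in Hyf'; rewrite (FG _ _ _ Hyf' Hyf) in Ha'.
      destruct (HG y f Hyf) as (_ & _ & Ff & _); now apply (Ff j).
    + intros a Ha; apply Hu in Ha as (y & Hy & Ha).
      destruct (Hg y Hy) as (i & Hi & Hiy), (Gtot y Hy) as (f & Hf).
      destruct (HG y f Hf) as (_ & Hfp & _ & Htot).
      destruct (Htot a Ha) as (j & Hj & Hja).
      destruct (opair_exists i j) as (w & Mw & Hw); eauto using Mt.
      exists w; split.
      * apply (opair_in_power d p q i j w); auto.
      * exists i; split; auto; exists j; split; auto; split; auto.
        exists y; split; auto; split; auto; exists f; split; auto.
        eauto using Mt.
  - apply (small_power k p q); auto; apply (small_power k d p); auto.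
    exists d; split; auto.
    apply (covered_intro (fun a b => a = b)); auto; [definability| |]; eauto.
    intros; congruence.
Qed.

(** * Lists *)

Lemma inter_exists x y :
  M x -> M y -> exists i, M i /\ forall z, z ∈ i <-> z ∈ x /\ z ∈ y.
Proof. intros Mx My; apply (separation (fun z => z ∈ y)); auto; definability. Qed.

Lemma Pkl_in_iff k l a :
  ordinal k -> M k -> M a -> Pkl_in M k l a <-> sub a l /\ small k a.
Proof.
  intros Hk Mk Ma; unfold Pkl_in; now rewrite sub_in_iff, card_lt_in_iff.
Qed.

Lemma Pkl_exists k l :
  M k -> M l ->
  exists p, M p /\ forall a, a ∈ p <-> M a /\ sub a l /\ small k a.
Proof.
  intros Mk Ml; destruct (power_exists l Ml) as (q & Mq & Hq).
  destruct (separation (fun a => small k a) q) as (p & Mp & Hp); auto.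
  { unfold small; definability. }
  exists p; split; auto; intros a; rewrite Hp, Hq; tauto.
Qed.

Lemma small_traces k p c s :
  ordinal k -> M k -> M p -> M c -> M s ->
  (forall x, x ∈ s -> exists t, t ∈ p /\ forall y, y ∈ x <-> y ∈ t /\ y ∈ c) ->
  small k p -> small k s.
Proof.
  intros Hk Mk Mp Mc Ms H; apply small_covered; auto.
  apply (covered_intro (fun t x => (forall y, y ∈ x -> y ∈ t /\ y ∈ c) /\
    forall y, y ∈ t -> y ∈ c -> y ∈ x)); auto.
  - definability.
  - intros t x x' _ _ _ [H1 H2] [H1' H2']; apply sub_antisym; intros y Hy.
    + destruct (H1 y Hy); auto.
    + destruct (H1' y Hy); auto.
  - intros x Hx; destruct (H x Hx) as (t & Ht & Hxt).
    exists t; split; auto; split; intros y Hy; [now apply Hxt|].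
    intros Hc; now apply Hxt.
Qed.

(** Having a value under [D] is a definable substitute for being a set of the smaller model, so
    choice can respect it. *)
Lemma cover_family x p D :
  M x -> M p -> M D ->
  (forall a, a ∈ x -> exists z, z ∈ p /\ sub a z /\ exists d, M d /\ app D z d) ->
  exists y, M y /\ covered y x /\
    (forall z, z ∈ y -> exists d, app D z d) /\
    (forall a, a ∈ x -> exists z, z ∈ y /\ sub a z).
Proof.
  intros Mx Mp MD H.
  destruct (choice_exists (fun a z => sub a z /\ exists d, M d /\ app D z d) x p)
    as (f & Mf & Ff & _ & Htot & Hf); auto; [definability|].
  destruct (separation (fun z => exists a, a ∈ x /\ app f a z) p) as (y & My & Hy);
    auto; [definability|].
  exists y; split; [|split; [|split]]; auto.
  - exists f; split; [|split]; auto; intros z Hz; now apply Hy.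
  - intros z Hz; apply Hy in Hz as (_ & a & _ & Hz).
    apply Hf in Hz as (_ & _ & _ & d & _ & Hd); eauto.
  - intros a Ha; destruct (Htot a Ha) as (z & Hz); exists z.
    destruct (Hf a z Hz) as (_ & Hzp & Haz & _); split; auto; apply Hy; eauto.
Qed.

(** Choice selects the restriction itself, from the power set of [l]; the set [z] that it comes from
    stays existentially quantified. *)
Lemma restricted_list_exists k l D :
  M k -> M l -> M D ->
  (forall a, M a -> sub a l -> small k a -> exists z d, app D z d /\ sub a z) ->
  exists E, M E /\ functional E /\
    (forall p, p ∈ E -> exists a b, opair a b p) /\
    (forall a, M a -> sub a l -> small k a -> exists b, app E a b) /\
    (forall a b, app E a b -> sub a l /\ small k a /\
       exists z d, app D z d /\ sub a z /\ forall y, y ∈ b <-> y ∈ d /\ y ∈ a).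
Proof.
  intros Mk Ml MD H.
  destruct (Pkl_exists k l) as (p & Mp & Hp); auto.
  destruct (power_exists l) as (q & Mq & Hq); auto.
  destruct (choice_exists (fun a b => exists z, M z /\ exists d, M d /\ app D z d /\
      sub a z /\ sub b a /\ forall y, y ∈ a -> y ∈ b <-> y ∈ d) p q)
    as (E & ME & FE & Hrel & Htot & HE); auto.
  - definability.
  - intros a Ha; apply Hp in Ha as (Ma & Hal & Has).
    destruct (H a Ma Hal Has) as (z & d & Hzd & Haz).
    destruct (app_dom D z d) as [Mz Md]; auto.
    destruct (inter_exists d a) as (b & Mb & Hb); auto.
    assert (Hba : sub b a) by (intros y Hy; now apply Hb).
    exists b; split.
    + apply Hq; split; auto; intros y Hy; auto.
    + exists z; split; auto; exists d; split; auto; split; [|split; [|split]]; auto.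
      intros y Hy; rewrite Hb; tauto.
  - exists E; split; [|split; [|split; [|split]]]; auto.
    + intros w Hw; destruct (Hrel w Hw) as (a & b & _ & _ & Hab); eauto.
    + intros a Ma Hal Has; apply Htot, Hp; auto.
    + intros a b Hab; apply HE in Hab as (Ha & _ & z & _ & d & _ & Hzd & Haz & Hba & Hb).
      apply Hp in Ha as (_ & Hal & Has); split; [|split]; auto.
      exists z, d; split; [|split]; auto; intros y; split.
      * intros Hy; pose proof (Hba y Hy); split; auto; now apply Hb.
      * intros [Hy Hya]; now apply Hb.
Qed.

Lemma traces_exist E c :
  M E -> M c ->
  exists S, M S /\ forall s, s ∈ S <-> M s /\
    exists a d, app E a d /\ sub c a /\ forall y, y ∈ s <-> y ∈ d /\ y ∈ c.
Proof.
  intros ME Mc; destruct (power_exists c Mc) as (q & Mq & Hq).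
  destruct (separation (fun s => exists a, M a /\ exists d, M d /\ app E a d /\
    sub c a /\ forall y, M y -> y ∈ s <-> y ∈ d /\ y ∈ c) q) as (S & MS & HS);
    auto; [definability|].
  exists S; split; auto; intros s; rewrite HS, Hq; split.
  - intros ((Ms & _) & a & _ & d & Md & Had & Hca & Hs); split; auto.
    exists a, d; split; [|split]; auto; intros y.
    split; intros Hy; apply Hs; auto; [eauto using Mt|].
    destruct Hy; eauto using Mt.
  - intros (Ms & a & d & Had & Hca & Hs); destruct (app_dom E a d) as [Ma Md]; auto.
    split; [split; auto; intros y Hy; now apply Hs|].
    exists a; split; auto; exists d; auto.
Qed.

End Model.

Arguments covered {U} M x y.
Arguments small {U} M k x.

(** * Passing between [V] and [W] by covering and approximation *)

Section CoverApproximation.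
Context {U : universe} {V W : class U}.
Context (HV : transitive_model V) (HW : transitive_model W)
  (HVW : forall x, V x -> W x).
Context {k l : U} (Vk : V k) (Vl : V l) (Hk : ordinal k) (Hcov : covering V W k).

Lemma small_upward x : small V k x -> small W k x.
Proof.
  intros (b & Hb & f & Vf & H); exists b; split; auto; exists f; auto.
Qed.

(** The set supplied by covering may leave [l]; its intersection with [l] is still in [V] and still
    contains [a]. *)
Lemma cover_subset a :
  W a -> sub a l -> small W k a ->
  exists z, V z /\ sub z l /\ small V k z /\ sub a z.
Proof.
  intros Wa Hal Ha.
  destruct (Hcov a Wa) as (z & Vz & Hz & Haz).
  - intros y Hy; apply (proj1 HV l); auto.
  - apply (card_lt_in_iff HW); auto.
  - apply (card_lt_in_iff HV) in Hz; auto.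
    destruct (inter_exists HV z l) as (z' & Vz' & Hz'); auto.
    exists z'; split; [|split; [|split]]; auto.
    + intros y Hy; now apply Hz'.
    + apply (small_sub k z' z); auto; intros y Hy; now apply Hz'.
    + intros y Hy; apply Hz'; auto.
Qed.

Context (Hreg : regular_in V k) (Hlim : strong_limit_in V k).
Context {D : U} (VD : V D) (HD : list_in V k l D).

Lemma list_dom z d :
  app D z d -> V z /\ V d /\ sub z l /\ small V k z /\ sub d z.
Proof.
  intros H; destruct (app_dom HV D z d) as [Vz Vd]; auto.
  destruct HD as [[Hrel _] Hsub].
  split; [|split]; auto.
  assert (sub z l /\ small V k z) as [Hz Hzs].
  { apply (Pkl_in_iff HV k l z); auto.
    destruct H as (p & Hp & Hzd).
    assert (Vp : V p) by exact (proj1 HV D p VD Hp).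
    destruct (Hrel p Vp Hp) as (a & Va & b & Vb & Ha & Hab).
    apply (opair_in_iff HV) in Hab; auto.
    now destruct (opair_inj _ _ _ _ _ Hzd Hab) as [-> _]. }
  split; [|split]; auto.
  apply (sub_in_iff HV); auto; apply Hsub; auto; now apply (app_in_iff HV).
Qed.

Lemma list_total z : V z -> sub z l -> small V k z -> exists d, app D z d.
Proof.
  intros Vz Hz Hzs; destruct HD as [[_ Htot] _].
  destruct (Htot z Vz) as (d & Vd & Hd & _).
  - now apply (Pkl_in_iff HV).
  - exists d; now apply (app_in_iff HV) in Hd.
Qed.

(* The members of x need not lie in V, but covers of them do, so covering applies
   to the family of covers and the union is computed in V. *)
Lemma small_union_of_covered x u :
  W x -> W u -> (forall a, a ∈ u -> exists y, y ∈ x /\ a ∈ y) ->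
  small W k x -> (forall y, y ∈ x -> sub y l /\ small W k y) -> small W k u.
Proof.
  intros Wx Wu Hu Hx Hmem.
  destruct (Pkl_exists HV k l) as (p & Vp & Hp); auto.
  destruct (cover_family HW x p D) as (y & Wy & Hyx & HyD & Hy); auto.
  { intros a Ha; destruct (Hmem a Ha) as [Hal Has].
    destruct (cover_subset a) as (z & Vz & Hz & Hzs & Haz); auto.
    { exact (proj1 HW x a Wx Ha). }
    exists z; split; [now apply Hp|split; auto].
    destruct (list_total z) as (d & Hd); auto.
    exists d; split; auto; now apply HVW, (list_dom z). }
  destruct (Hcov y Wy) as (z & Vz & Hzs & Hyz).
  { intros a Ha; destruct (HyD a Ha) as (d & Hd); now apply (list_dom a d). }
  { apply (card_lt_in_iff HW); auto; apply (small_covered HW k y x); auto. }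
  apply (card_lt_in_iff HV) in Hzs; auto.
  destruct (inter_exists HV z p) as (z' & Vz' & Hz'); auto.
  destruct (union_exists HV z') as (v & Vv & Hv); auto.
  apply (small_sub k u v).
  - intros a Ha; destruct (Hu a Ha) as (b & Hb & Hab).
    destruct (Hy b Hb) as (c & Hc & Hbc).
    apply Hv; exists c; split; auto; apply Hz'; split; auto.
    destruct (HyD c Hc) as (d & Hd); apply Hp.
    destruct (list_dom c d Hd) as (? & _ & ? & ? & _); auto.
  - apply small_upward, (small_union HV k z' v); auto.
    + apply (small_sub k z' z); auto; intros a Ha; now apply Hz'.
    + intros a Ha; apply Hz' in Ha as [_ Ha]; now apply Hp in Ha.
Qed.

Lemma thin_of_restriction E :
  W E ->
  (forall a b, app E a b -> sub a l /\ small W k a /\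
     exists z d, app D z d /\ sub a z /\ forall y, y ∈ b <-> y ∈ d /\ y ∈ a) ->
  thin_in W k l E.
Proof.
  intros WE HE; assert (Wk : W k) by auto; assert (Wl : W l) by auto.
  assert (HPkl : forall a, W a -> Pkl_in W k l a <-> sub a l /\ small W k a)
    by (intros; now apply (Pkl_in_iff HW)).
  destruct (Pkl_exists HW k l) as (C & WC & HC); auto.
  exists C; split; auto; split; [split; [|split]|].
  - intros c Wc Hc; apply HPkl, HC; auto.
  - intros a Wa Ha; exists a; split; auto; split; [|now intros y].
    apply HC; split; auto; now apply HPkl.
  - intros x Wx Hx _ Hxs _ u Wu Hu.
    apply (card_lt_in_iff HW) in Hxs; auto.
    assert (Hmem : forall y, y ∈ x -> sub y l /\ small W k y).
    { intros y Hy; assert (Wy : W y) by exact (proj1 HW x y Wx Hy).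
      now apply HC, Hx. }
    assert (Hux : forall a, a ∈ u -> exists y, y ∈ x /\ a ∈ y).
    { intros a Ha; assert (Wa : W a) by exact (proj1 HW u a Wu Ha).
      apply (Hu a Wa) in Ha as (y & _ & H); eauto. }
    apply HC; split; [|split]; auto.
    + intros a Ha; destruct (Hux a Ha) as (y & Hy & Hay); now apply (Hmem y).
    + now apply (small_union_of_covered x u).
  - intros c Wc Hc; apply HC in Hc as (_ & Hcl & Hcs).
    destruct (traces_exist HW E c) as (S & WS & HS); auto.
    exists S; split; auto; split.
    + intros s Ws; rewrite HS; split.
      * intros (_ & a & d & Had & Hca & Hs).
        destruct (app_dom HW E a d) as [Wa Wd]; auto.
        destruct (HE a d Had) as (Hal & Has & _).
        exists a; split; auto; split; [now apply HPkl|split].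
        { now apply (sub_in_iff HW). }
        exists d; split; auto; split; [now apply (app_in_iff HW)|].
        intros y _; apply Hs.
      * intros (a & Wa & _ & Hca & d & Wd & Had & Hs); split; auto.
        apply (sub_in_iff HW) in Hca; auto; apply (app_in_iff HW) in Had; auto.
        exists a, d; split; [|split]; auto; intros y; split.
        -- intros Hy; apply Hs; auto; exact (proj1 HW s y Ws Hy).
        -- intros [Hy Hyc]; apply Hs; auto; exact (proj1 HW d y Wd Hy).
    + apply (card_lt_in_iff HW); auto.
      destruct (cover_subset c) as (z & Vz & Hzl & Hzs & Hcz); auto.
      destruct (power_exists HV z) as (p & Vp & Hp); auto.
      apply (small_traces HW k p c S); auto.
      * intros s Hs; apply HS in Hs as (_ & a & b & Hab & Hca & Hs).
        destruct (HE a b Hab) as (_ & _ & w & d & Hwd & _ & Hb).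
        destruct (list_dom w d Hwd) as (_ & Vd & _).
        (* Here [b] is [d ∩ a], and [c] is contained in both [a] and [z]; so [b] and [d ∩ z] have
           the same trace on [c], and [d ∩ z] lies in [V]. *)
        destruct (inter_exists HV d z) as (t & Vt & Ht); auto.
        exists t; split.
        -- apply Hp; split; auto; intros y Hy; now apply Ht.
        -- intros y; rewrite Hs, Ht, Hb.
           specialize (Hca y); specialize (Hcz y); tauto.
      * apply small_upward, (small_power HV k z p); auto.
Qed.

Lemma cofinal_branch_downward (Happ : approximation V W k) d :
  W d -> sub d l ->
  (forall a, V a -> sub a l -> small V k a -> exists z e, app D z e /\ sub a z /\
     forall y, y ∈ a -> y ∈ d <-> y ∈ e) ->
  V d /\ cofinal_branch_in V k l D d.
Proof.
  intros Wd Hdl H.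
  assert (Vd : V d).
  { apply Happ; auto.
    - intros y Hy; apply (proj1 HV l); auto.
    - intros z Vz _ Hzs; apply (card_lt_in_iff HV) in Hzs; auto.
      (* Approximation tests [d] on arbitrary small [z] of [V]; since [d] is contained in [l], only
         [z ∩ l] matters, and there [d] agrees with a set of [V]. *)
      destruct (inter_exists HV z l) as (a & Va & Ha); auto.
      destruct (H a Va) as (w & e & Hwe & _ & He).
      { intros y Hy; now apply Ha. }
      { apply (small_sub k a z); auto; intros y Hy; now apply Ha. }
      destruct (list_dom w e Hwe) as (_ & Ve & _).
      destruct (inter_exists HV e a) as (i & Vi & Hi); auto.
      exists i; split; auto; intros y; rewrite Hi; split.
      + intros [Hye Hya]; split; [now apply He|now apply Ha].
      + intros [Hyd Hyz]; assert (Hya : y ∈ a) by (apply Ha; auto).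
        split; auto; now apply He. }
  split; auto; split; [now apply (sub_in_iff HV)|].
  intros a Va Ha; apply (Pkl_in_iff HV) in Ha as [Hal Has]; auto.
  destruct (H a Va Hal Has) as (z & e & Hze & Haz & He).
  destruct (list_dom z e Hze) as (Vz & Ve & Hzl & Hzs & _).
  exists z; split; auto; split; [now apply (Pkl_in_iff HV)|split].
  { now apply (sub_in_iff HV). }
  exists e; split; auto; split; [now apply (app_in_iff HV)|].
  destruct (inter_exists HV d a) as (i & Vi & Hi); auto.
  exists i; split; auto; split; intros y _; rewrite Hi; [reflexivity|].
  split; intros [Hy Hya]; split; auto; now apply (He y Hya).
Qed.

End CoverApproximation.

Theorem theorem6p4 (U : universe) (V W : class U)
  (HV : transitive_model V) (HW : transitive_model W)
  (HVW : forall x, V x -> W x)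
  (kappa lambda : U) (Hkappa : V kappa) (Hlambda : V lambda)
  (Hcov : covering V W kappa) (Happ : approximation V W kappa)
  (Hinacc : inaccessible_in V kappa)
  (Hcard : cardinal_in V lambda)
  (Hle : kappa ∈ lambda \/ kappa = lambda)
  (HTP : TP_in W kappa lambda) :
  TP_in V kappa lambda.
Proof.
  destruct Hinacc as ((Hk & _) & _ & Hreg & Hlim).
  apply (ordinal_in_iff HV) in Hk; auto.
  intros D VD HD _.
  assert (Wk : W kappa) by auto; assert (Wl : W lambda) by auto.
  destruct (restricted_list_exists HW kappa lambda D)
    as (E & WE & FE & Hrel & Htot & HE); auto.
  { intros a Wa Hal Has.
    destruct (cover_subset HV HW HVW Hkappa Hlambda Hk Hcov a)
      as (z & Vz & Hzl & Hzs & Haz); auto.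
    destruct (list_total HV Hkappa Hk VD HD z) as (d & Hd); eauto. }
  assert (HPkl : forall a, W a ->
    Pkl_in W kappa lambda a <-> sub a lambda /\ small W kappa a)
    by (intros; now apply (Pkl_in_iff HW)).
  destruct (HTP E WE) as (d & Wd & Hdl & Hd).
  - split; [split|].
    + intros p Wp Hp; destruct (Hrel p Hp) as (a & b & Hab).
      assert (Happ_ab : app E a b) by (exists p; auto).
      destruct (app_dom HW E a b) as [Wa Wb]; auto.
      destruct (HE a b Happ_ab) as (Hal & Has & _).
      exists a; split; auto; exists b; split; auto; split; [now apply HPkl|].
      now apply (opair_in_iff HW).
    + intros a Wa Ha; apply HPkl in Ha as [Hal Has]; auto.
      destruct (Htot a Wa Hal Has) as (b & Hb).
      destruct (app_dom HW E a b) as [_ Wb]; auto.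
      exists b; split; auto; split; [now apply (app_in_iff HW)|].
      intros c Wc Hc; apply (app_in_iff HW) in Hc; auto; now apply (FE a).
    + intros a Wa b Wb Hab y _ Hy; apply (app_in_iff HW) in Hab; auto.
      destruct (HE a b Hab) as (_ & _ & z & e & _ & _ & Hb); now apply Hb.
  - apply (thin_of_restriction HV HW HVW Hkappa Hlambda Hk Hcov Hreg Hlim VD HD);
      auto.
  - apply (sub_in_iff HW) in Hdl; auto.
    destruct (cofinal_branch_downward HV Hkappa Hlambda Hk VD HD Happ d)
      as [Vd Hbr]; eauto.
    intros a Va Hal Has.
    destruct (Hd a) as (b & Wb & _ & Hab & f & Wf & Hbf & i & Wi & Hi & Hi'); auto.
    { apply HPkl; auto; split; auto; now apply (small_upward HVW). }
    apply (app_in_iff HW) in Hbf; auto; apply (sub_in_iff HW) in Hab; auto.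
    (* As [a ⊆ b ⊆ z] and [f] is [e ∩ b], agreement of [d] with [f] on [a] is agreement with [e], a
       value of [D]. *)
    destruct (HE b f Hbf) as (_ & _ & z & e & Hze & Hbz & Hf).
    exists z, e; split; [|split]; auto.
    + intros y Hy; apply Hbz; auto.
    + intros y Hy; assert (Wy : W y) by (apply (proj1 HW a); auto).
      specialize (Hi y Wy); specialize (Hi' y Wy); specialize (Hf y).
      specialize (Hab y Hy); tauto.
Qed.
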